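(* Let $k$ be a field and let $n \geq 2$ be an integer. The irreducible components of the scheme $\mathscr{F}_n$ of $3\times 3$ singular matrices of linear forms in $n$ variables are the varieties $\mathscr{R}_n$, $\mathscr{S}_n$, $\mathscr{A}_n$, $\mathscr{C}_n$. If $n \geq 3$, these four varieties are pairwise distinct, so that $\mathscr{F}_n$ has exactly four irreducible components; if $n = 2$, then $\mathscr{A}_2 = \mathscr{S}_2$ and $\mathscr{F}_2$ has exactly the three irreducible components $\mathscr{R}_2$, $\mathscr{A}_2 = \mathscr{S}_2$, $\mathscr{C}_2$.
   Context: Let $R = k[x_1,\ldots,x_n]$. Let $\mathscr{M}_n$ be the $9n$-dimensional $k$-vector space of $3\times 3$ matrices whose entries are linear forms in $R$ (zero allowed), and let $\mathbb{P}\mathscr{M}_n \simeq \mathbb{P}^{9n-1}$ be the associated projective space. The determinant is a map from $\mathscr{M}_n$ to the $\binom{n+2}{3}$-dimensional space of cubic forms in $R$; the coefficients of the determinant are $\binom{n+2}{3}$ cubic forms in the coordinates of $\mathscr{M}_n$, and $\mathscr{F}_n \subset \mathbb{P}\mathscr{M}_n$ is the closed subscheme defined by their simultaneous vanishing. Define linear subspaces of $\mathbb{P}\mathscr{M}_n$ consisting of the (classes of) non-zero matrices of linear forms of the following shapes, where $\star,\varphi,\chi,\psi$ denote arbitrary linear forms in $R$: $R_n$: $\begin{pmatrix} \star & \star & \star \\ \star & \star & \star \\ 0 & 0 & 0 \end{pmatrix}$; $S_n$: $\begin{pmatrix} \star & \star & \star \\ \star & 0 & 0 \\ \star & 0 &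 0 \end{pmatrix}$; $A_n$: $\begin{pmatrix} 0 & \varphi & -\chi \\ -\varphi & 0 & \psi \\ \chi & -\psi & 0 \end{pmatrix}$; $C_n$: $\begin{pmatrix} \star & \star & 0 \\ \star & \star & 0 \\ \star & \star & 0 \end{pmatrix}$. The algebraic group $G = \mathrm{GL}_3 \times \mathrm{GL}_3$ over $k$ acts on $\mathscr{M}_n$, and hence on $\mathbb{P}\mathscr{M}_n$, by $(f,g)\cdot m = f m g^t$. The varieties $\mathscr{R}_n$, $\mathscr{S}_n$, $\mathscr{A}_n$, $\mathscr{C}_n$ are the Zariski closures in $\mathbb{P}\mathscr{M}_n$ of the $G$-orbits of $R_n$, $S_n$, $A_n$, $C_n$ respectively, that is, the closures of the images of the action morphisms $G \times R_n \to \mathbb{P}\mathscr{M}_n$, $G \times S_n \to \mathbb{P}\mathscr{M}_n$, $G \times A_n \to \mathbb{P}\mathscr{M}_n$, $G \times C_n \to \mathbb{P}\mathscr{M}_n$. Irreducible components are those of the underlying topological space. *)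

(* Defs.v *)
From HB Require Import structures.
From mathcomp Require Import all_boot all_order all_algebra.
From mathcomp Require Import ring_quotient mpoly.
From mathcomp Require Import boolp classical_sets functions cardinality.
From mathcomp Require Import topology.

Set Implicit Arguments.
Unset Strict Implicit.
Unset Printing Implicit Defensive.

Import GRing.Theory.
Local Open Scope classical_set_scope.
Local Open Scope ring_scope.

Section Irreducible.
Context {T : topologicalType}.

Definition irreducible (A : set T) : Prop :=
  A !=set0 /\
  forall F G : set T, closed F -> closed G ->
    A `<=` F `|` G -> A `<=` F \/ A `<=` G.

(* A subset is irreducible for the topology of [T] iff it is irreducible for
   the topology induced on any [X] containing it, so these are the irreducible
   components of the subspace [X]. *)
Definition irreducible_components (X : set T) : set (set T) :=
  [set Z | [/\ Z `<=` X, irreducible Z &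
     forall Y : set T, Y `<=` X -> irreducible Y -> Z `<=` Y -> Y = Z]].

End Irreducible.

(* The underlying topological space of Proj k[X_0, .., X_(N-1)] = P^(N-1)_k. *)
Section Proj.
Context {k : fieldType} {N : nat}.

Definition homogeneous_ideal (I : {pred {mpoly k[N]}}) : Prop :=
  forall p, p \in I -> forall d, pihomog mdeg d p \in I.

Record proj := Proj {
  proj_ideal :> {pred {mpoly k[N]}};
  proj_is_ideal : idealr_closed proj_ideal;
  proj_is_prime : prime_idealr_closed proj_ideal;
  proj_is_homogeneous : homogeneous_ideal proj_ideal;
  proj_relevant : ~ (forall i : 'I_N, 'X_i \in proj_ideal)
}.

HB.instance Definition _ := gen_eqMixin proj.
HB.instance Definition _ := gen_choiceMixin proj.

Definition zeros (E : set {mpoly k[N]}) : set proj :=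
  [set x | forall p, E p -> p \in proj_ideal x].

Definition zariski_open : set (set proj) :=
  [set U | exists E : set {mpoly k[N]}, U = ~` zeros E].

Lemma zariski_openT : zariski_open setT.
Proof.
exists [set 1]; apply/esym; rewrite -subTset => x _ /(_ 1 erefl).
by case: (proj_is_ideal x) => _ /negP.
Qed.

Lemma zariski_openI : setI_closed zariski_open.
Proof.
move=> _ _ [E ->] [F ->].
exists [set r | exists p q, [/\ E p, F q & r = p * q]].
rewrite -setCU; congr (~` _); apply/seteqP; split=> x.
  have [_ _ idx] := proj_is_ideal x; have [x0 _ _] := proj_is_ideal x.
  case=> Vx _ [p [q [Ep Fq ->]]].
    by rewrite mulrC -[q * p]addr0; apply: idx => //; apply: Vx.
  by rewrite -[p * q]addr0; apply: idx => //; apply: Vx.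
move=> Vx; apply: contrapT => /not_orP[/existsNP[p /not_implyP[Ep /negP xp]]].
move=> /existsNP[q /not_implyP[Fq /negP xq]].
have xpq : p * q \in proj_ideal x by apply: Vx; exists p, q.
by have := proj_is_prime xpq; rewrite (negbTE xp) (negbTE xq).
Qed.

Lemma zariski_open_bigU (I : Type) (U : I -> set proj) :
  (forall i, zariski_open (U i)) -> zariski_open (\bigcup_i U i).
Proof.
move=> /choice[E UE]; exists (\bigcup_i E i).
apply/seteqP; split=> [x [i _]|x /existsNP[p /not_implyP[[i _ Ep] xp]]].
  by rewrite UE => Vx Wx; apply: Vx => p Ep; apply: Wx; exists i.
by exists i => //; rewrite UE => /(_ p Ep).
Qed.

HB.instance Definition _ := isOpenTopological.Build proj
  zariski_openT zariski_openI zariski_open_bigU.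

(* For a field extension [iota : k -> K] and a nonzero [v : K^N], the image
   point of the morphism Spec K -> P^(N-1)_k with homogeneous coordinates [v]
   is the prime whose homogeneous elements are the forms vanishing at [v]. *)
Definition point_of (K : fieldType) (iota : {rmorphism k -> K})
    (v : 'I_N -> K) (x : proj) : Prop :=
  forall (d : nat) (p : {mpoly k[N]}), p \is d.-homog ->
    (p \in proj_ideal x) = ((map_mpoly iota p).@[v] == 0).

End Proj.

Arguments proj k N : clear implicits.

(* The coordinate (i, j, l) of a matrix of linear forms is the coefficient of
   x_l in its entry (i, j). *)
Definition coord_idx (n : nat) : finType := ('I_3 * 'I_3 * 'I_n)%type.

Definition PM (k : fieldType) (n : nat) := proj k #|coord_idx n|.

Definition coords (K : fieldType) (n : nat) (m : 'M[{mpoly K[n]}]_3)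
    (a : 'I_#|coord_idx n|) : K :=
  let: (i, j, l) := enum_val a in (m i j)@_U_(l).

Section Singular.
Variables (k : fieldType) (n : nat).

Definition generic_matrix : 'M[{mpoly {mpoly k[#|coord_idx n|]}[n]}]_3 :=
  \matrix_(i, j) \sum_(l < n) 'X_(enum_rank ((i, j, l) : coord_idx n)) *: 'X_l.

Definition det_coeffs : set {mpoly k[#|coord_idx n|]} :=
  [set (\det generic_matrix)@_u | u in [set u : 'X_{1..n} | mdeg u = 3%N]].

Definition singular_locus : set (PM k n) := zeros det_coeffs.

End Singular.

Arguments singular_locus k n : clear implicits.

Section Shapes.
Variables (n : nat) (K : fieldType).

Definition linear_entries (m : 'M[{mpoly K[n]}]_3) : Prop :=
  forall i j, m i j \is 1.-homog.

Definition mx3 (s : seq (seq {mpoly K[n]})) : 'M[{mpoly K[n]}]_3 :=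
  \matrix_(i, j) nth 0 (nth [::] s i) j.

Definition shapeR : set 'M[{mpoly K[n]}]_3 :=
  [set m | linear_entries m /\ exists a b c d e f,
     m = mx3 [:: [:: a; b; c];
                 [:: d; e; f];
                 [:: 0; 0; 0]]].

Definition shapeS : set 'M[{mpoly K[n]}]_3 :=
  [set m | linear_entries m /\ exists a b c d e,
     m = mx3 [:: [:: a; b; c];
                 [:: d; 0; 0];
                 [:: e; 0; 0]]].

Definition shapeA : set 'M[{mpoly K[n]}]_3 :=
  [set m | linear_entries m /\ exists phi chi psi,
     m = mx3 [:: [:: 0;      phi;   - chi];
                 [:: - phi;  0;     psi  ];
                 [:: chi;    - psi; 0    ]]].

Definition shapeC : set 'M[{mpoly K[n]}]_3 :=
  [set m | linear_entries m /\ exists a b c d e f,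
     m = mx3 [:: [:: a; b; 0];
                 [:: c; d; 0];
                 [:: e; f; 0]]].

Definition act (f g : 'M[K]_3) (m : 'M[{mpoly K[n]}]_3) :
    'M[{mpoly K[n]}]_3 :=
  map_mx (@mpolyC n K) f *m m *m (map_mx (@mpolyC n K) g)^T.

End Shapes.

Arguments shapeR n K : clear implicits.
Arguments shapeS n K : clear implicits.
Arguments shapeA n K : clear implicits.
Arguments shapeC n K : clear implicits.

Section OrbitClosure.
Variables (k : fieldType) (n : nat).

(* The set-theoretic image of GL_3 x GL_3 x P(L) -> PM: every point of a
   k-scheme is the image of a K-point for some field extension K of k, hence
   the quantification over all extensions. *)
Definition orbit (L : forall K : fieldType, set 'M[{mpoly K[n]}]_3) :
    set (PM k n) :=
  [set x | exists (K : fieldType) (iota : {rmorphism k -> K})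
       (f g : 'M[K]_3) (m : 'M[{mpoly K[n]}]_3),
     [/\ f \in unitmx, g \in unitmx, L K m, m != 0 &
         point_of iota (coords (act f g m)) x]].

Definition varR : set (PM k n) := closure (orbit (shapeR n)).
Definition varS : set (PM k n) := closure (orbit (shapeS n)).
Definition varA : set (PM k n) := closure (orbit (shapeA n)).
Definition varC : set (PM k n) := closure (orbit (shapeC n)).

End OrbitClosure.

Arguments varR k n : clear implicits.
Arguments varS k n : clear implicits.
Arguments varA k n : clear implicits.
Arguments varC k n : clear implicits.

(* Main.v *)
Require Import Defs.
From Stdlib Require Import setoid_ring.Ring.
From HB Require Import structures.
From mathcomp Require Import all_boot all_order all_algebra.
From mathcomp Require Import fraction ring_quotient mpoly.
From mathcomp Require Import boolp classical_sets functions cardinality.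
From mathcomp Require Import topology.

Set Implicit Arguments.
Unset Strict Implicit.
Unset Printing Implicit Defensive.

Import GRing.Theory.
Local Open Scope classical_set_scope.
Local Open Scope ring_scope.

(** Writing a matrix of linear forms as m = x_1 T_1 + ... + x_n T_n, with
    constant 3 x 3 matrices T_l, turns a point of P(M_n) over an extension K of
    k into a tensor T, and turns the four linear subspaces into conditions on
    each T_l separately: being fixed by a linear projection of the space of
    3 x 3 matrices onto the matrices of shape R, S, A or C ([has_shape],
    [orbitP]).

    Set-theoretically, the singular locus is the union of the four orbits.
    One inclusion holds because a matrix of any of the shapes has zero
    determinant.  For the other, a point has a tensor over its residue field K,
    and K has an element other than 0 and 1, namely a coordinate, which is
    transcendental over k.  All linear combinations M(t) of the T_l are then
    singular, and a linear family of singular matrices over a field with at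
    least three elements can be brought to one of the four shapes by row and
    column operations ([normal_shape_singular]).  If all ranks are at most 1
    and some M(s) is E_00, then M has shape S.  If some M(s) is diag(1, 1, 0),
    then det (c M(s) + M(t)) = 0 for all c forces M(t)_22 = 0 and
    c(t) b(t) = 0, where b is the column (M_02, M_12) and c the row
    (M_20, M_21).  Here b = 0 gives C, c = 0 gives R, two proportional forms
    b_0, b_1 give S (or C, or R), and independent b_0, b_1 give
    c = lambda (- b_1, b_0), from which det M = 0 leads to A.

    Each orbit closure is irreducible because it is the closure of one point:
    the point x_s whose coordinates are those of f T g^t for f, g and T filled
    with indeterminates.  A form that vanishes at x_s vanishes at every point
    of the orbit, by specialization ([generic_point]).  So the irreducible
    components are the maximal ones among the four closures
    ([components_orbit_closures]).

    Non-inclusions are witnessed by 3 x 3 determinants that vanish on one orbit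
    and not at some k-point of another ([separation]).  On R, the T_l have a
    common left kernel, so any three columns taken from them are dependent.  On
    A, the rows of a given index i in the T_l are the f_i A_l g^t, where f_i is
    a fixed row and the A_l are alternating, so they are all orthogonal to
    g^-t f_i^t.  On S, every row of every M(t) lies in the span of some
    rho(t) and a vector beta independent of t, so that the cross products of
    two rows are all orthogonal to beta.  Transposition exchanges R and C and
    yields the remaining cases.  Separating A from S, and the other shapes from
    A, takes three variables; for n = 2, a generic tensor of shape A can be
    brought to shape S and conversely, by solving 2 x 2 linear systems, whence
    A_2 = S_2 ([orbit_closure_A_eq_S]). *)

(** * Residue fields of prime ideals *)

Section ResidueField.
Context (R : comNzRingType) (I : prime_idealr R).

Definition residue_ring : Type := {ideal_quot I}.

HB.instance Definition _ := GRing.ComNzRing.on residue_ring.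

Definition residue_unit : {pred residue_ring} :=
  fun x => `[< exists y, y * x = 1 >].

Definition residue_inv (x : residue_ring) : residue_ring :=
  if pselect (exists y, y * x = 1) is left xV then projT1 (cid xV) else x.

Fact residue_mulVx : {in residue_unit, left_inverse 1 residue_inv *%R}.
Proof.
move=> x /asboolP xV; rewrite /residue_inv.
by case: pselect => // {}xV; case: cid.
Qed.

Fact residue_unitPl (x y : residue_ring) : y * x = 1 -> residue_unit x.
Proof. by move=> yx; apply/asboolP; exists y. Qed.

Fact residue_inv_out : {in [predC residue_unit], residue_inv =1 id}.
Proof.
move=> x /asboolPn xNV; rewrite /residue_inv.
by case: pselect.
Qed.

HB.instance Definition _ := GRing.ComNzRing_hasMulInverse.Build residue_ring
  residue_mulVx residue_unitPl residue_inv_out.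

Fact residue_integral : GRing.integral_domain_axiom residue_ring.
Proof. exact: Quotient.rquot_IdomainAxiom. Qed.

HB.instance Definition _ :=
  GRing.ComUnitRing_isIntegral.Build residue_ring residue_integral.

Definition residue_map : R -> {fraction residue_ring} :=
  fun r => @FracField.tofrac residue_ring (\pi_({ideal_quot I}) r)%qT.

Fact residue_map_zmod_morphism : zmod_morphism residue_map.
Proof. by move=> x y; rewrite /residue_map !rmorphB. Qed.

Fact residue_map_monoid_morphism : monoid_morphism residue_map.
Proof. by split=> [|x y]; rewrite /residue_map ?rmorph1 ?rmorphM. Qed.

HB.instance Definition _ := GRing.isZmodMorphism.Build R {fraction residue_ring}
  residue_map residue_map_zmod_morphism.
HB.instance Definition _ := GRing.isMonoidMorphism.Build R
  {fraction residue_ring} residue_map residue_map_monoid_morphism.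

Lemma residue_map_eq0 r : (residue_map r == 0) = (r \in I).
Proof.
rewrite tofrac_eq0 -[r in RHS]subr0 Quotient.idealrBE.
by rewrite -[X in _ == X](rmorph0 (\pi_({ideal_quot I}))%qT).
Qed.

End ResidueField.

(** The quotient by a prime ideal is given the structure of an integral domain
    by choosing inverses classically; K is its field of fractions. *)
Lemma residue_field (R : comNzRingType) (I : {pred R}) :
  idealr_closed I -> prime_idealr_closed I ->
  exists (K : fieldType) (phi : {rmorphism R -> K}),
    forall r, (r \in I) = (phi r == 0).
Proof.
move=> idI prI.
pose I' : prime_idealr R := HB.pack (I : R -> bool) (isIdealr.Build R I idI)
  (isPrimeIdealrClosed.Build R I prI).
exists {fraction residue_ring I'}, (residue_map I' : {rmorphism _ -> _}) => r.
by rewrite residue_map_eq0.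
Qed.

(** * Polynomials evaluated in extension rings *)

Section Evaluation.
Context {k : fieldType} {N : nat}.

Definition evalp (S : comNzRingType) (iota : {rmorphism k -> S})
    (v : 'I_N -> S) : {mpoly k[N]} -> S :=
  meval v \o map_mpoly iota.

HB.instance Definition _ (S : comNzRingType) (iota : {rmorphism k -> S})
  (v : 'I_N -> S) := GRing.RMorphism.on (evalp iota v).

Lemma evalpC (S : comNzRingType) (iota : {rmorphism k -> S}) v a :
  evalp iota v a%:MP = iota a.
Proof. by rewrite /evalp /= map_mpolyC mevalC. Qed.

Lemma evalpX (S : comNzRingType) (iota : {rmorphism k -> S}) v i :
  evalp iota v 'X_i = v i.
Proof. by rewrite /evalp /= map_mpolyX mevalXU. Qed.

Lemma rmorph_mpolyE (S : comNzRingType) (phi : {rmorphism {mpoly k[N]} -> S}) p :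
  phi p = \sum_(m <- msupp p) phi (p@_m)%:MP * \prod_i phi 'X_i ^+ m i.
Proof.
rewrite {1}[p]mpolyE rmorph_sum; apply: eq_bigr => m _.
rewrite -mul_mpolyC rmorphM mpolyXE_id rmorph_prod; congr (_ * _).
by apply: eq_bigr => i _; rewrite rmorphXn.
Qed.

(** A form of degree d evaluated at a scaled point is multiplied by the d-th
    power of the scaling factor; phi and psi evaluate at the two points. *)
Lemma rmorph_homog (S : comNzRingType)
    (phi psi : {rmorphism {mpoly k[N]} -> S}) c d p :
  (forall a, phi a%:MP = psi a%:MP) -> (forall i, phi 'X_i = c * psi 'X_i) ->
  p \is d.-homog -> phi p = c ^+ d * psi p.
Proof.
move=> eqC eqX /dhomogP pd; rewrite !rmorph_mpolyE mulr_sumr.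
apply: eq_big_seq => m /pd <-; rewrite eqC mulrCA; congr (_ * _).
under eq_bigr do rewrite eqX exprMn.
by rewrite big_split prodrXr -mdegE.
Qed.

Lemma rmorph_mpoly_ext (S : comNzRingType)
    (phi psi : {rmorphism {mpoly k[N]} -> S}) :
  (forall a, phi a%:MP = psi a%:MP) -> (forall i, phi 'X_i = psi 'X_i) ->
  phi =1 psi.
Proof.
move=> eqC eqX p; rewrite !rmorph_mpolyE.
by under eq_bigr do (rewrite eqC; under eq_bigr do rewrite eqX).
Qed.

End Evaluation.

(** * Points of projective space and their closures *)

Section ProjPoints.
Context {k : fieldType} {N : nat}.
Implicit Types x y : proj k N.

Lemma closed_zeros (E : set {mpoly k[N]}) : closed (zeros E).
Proof. by rewrite -openC; exists E. Qed.

Lemma closedP (A : set (proj k N)) : closed A -> exists E, A = zeros E.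
Proof. by rewrite -openC => -[E /(congr1 (@setC _))]; rewrite !setCK; exists E. Qed.

Lemma homog_sub_sub x y :
  (forall d p, p \is d.-homog -> p \in proj_ideal x -> p \in proj_ideal y) ->
  forall p, p \in proj_ideal x -> p \in proj_ideal y.
Proof.
move=> xy p xp; rewrite (pihomog_partitionE (leqnn (mmeasure mdeg p))).
have [y0 _ yD] := proj_is_ideal y.
elim/big_rec: _ => [//|d q _ yq]; rewrite -[pihomog _ _ _]mul1r; apply: yD => //.
by apply: (xy d); rewrite ?pihomogP//; apply: proj_is_homogeneous.
Qed.

(** If every point of A is a specialization of a point x of A, then A and x
    have the same closure. *)
Lemma closure_generic (A : set (proj k N)) x :
  A x ->
  (forall y, A y -> forall p, p \in proj_ideal x -> p \in proj_ideal y) ->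
  closure A = [set y | forall p, p \in proj_ideal x -> p \in proj_ideal y].
Proof.
move=> Ax xA; apply/seteqP; split=> y.
  rewrite closureE => /(_ (zeros [set p | p \in proj_ideal x])); apply.
  by split; [exact: closed_zeros | exact: xA].
move=> xy; rewrite closureE => B [/closedP[E ->] AE] p Ep.
by apply: xy; apply: AE.
Qed.

Lemma irreducible_closure_generic (A : set (proj k N)) x :
  A x ->
  (forall y, A y -> forall p, p \in proj_ideal x -> p \in proj_ideal y) ->
  irreducible (closure A).
Proof.
move=> Ax xA; have xcl : closure A x by apply: subset_closure.
have gen F : closed F -> F x -> closure A `<=` F.
  move=> /closedP[E ->] Fx; rewrite (closure_generic Ax xA) => y xy p Ep.
  by apply: xy; apply: Fx.
split; first by exists x.
by move=> F G clF clG /(_ x xcl)[Fx|Gx]; [left|right]; apply: gen.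
Qed.

(** The ideal of the image point of v is the kernel of p |-> p(v X) in K[X].
    It is prime because K[X] is a domain, and homogeneous because the
    coefficient of X^d in p(v X) is the value at v of the part of degree d of
    p. *)
Lemma exists_point (K : fieldType) (iota : {rmorphism k -> K}) (v : 'I_N -> K) :
  (exists i, v i != 0) -> exists x : proj k N, point_of iota v x.
Proof.
move=> [i0 vi0].
pose psi : {rmorphism {mpoly k[N]} -> {poly K}} :=
  evalp (polyC \o iota) (fun i => v i *: 'X).
have psiE d p : p \is d.-homog -> psi p = (evalp iota v p)%:P * 'X^d.
  move=> pd; rewrite mulrC.
  rewrite -[(evalp iota v p)%:P]/((polyC \o evalp iota v) p).
  apply: rmorph_homog pd => [a|i] /=; first by rewrite !evalpC.
  by rewrite !evalpX -mul_polyC mulrC.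
have psi_coef d p : (psi p)`_d = evalp iota v (pihomog mdeg d p).
  pose w := (maxn (mmeasure mdeg p) d.+1).
  have -> : psi p = \sum_(e < w) psi (pihomog mdeg e p).
    by rewrite {1}(@pihomog_partitionE _ _ mdeg w p) ?leq_maxl// rmorph_sum.
  rewrite coef_sum.
  have dw : (d < w)%N by rewrite leq_maxr.
  rewrite (bigD1 (Ordinal dw)) //= big1 => [|e ed].
    by rewrite (psiE d) ?pihomogP// coefMXn ltnn subnn coefC eqxx addr0.
  rewrite (psiE e) ?pihomogP// coefMXn; case: ltnP => // le_ed.
  by rewrite coefC subn_eq0 leqNgt ltn_neqAle le_ed andbT ed.
have psiX i : psi 'X_i = v i *: 'X by exact: evalpX.
move: psi psiX psiE psi_coef => psi psiX psiE psi_coef.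
pose I : {pred {mpoly k[N]}} := [pred p | psi p == 0].
have I_ideal : idealr_closed I.
  split=> [||a p q]; first by rewrite inE rmorph0.
    by rewrite inE rmorph1 oner_eq0.
  by rewrite !inE rmorphD rmorphM => /eqP-> /eqP->; rewrite mulr0 addr0.
have I_prime : prime_idealr_closed I.
  by move=> p q; rewrite !inE rmorphM mulf_eq0.
have I_homog : homogeneous_ideal I.
  move=> p; rewrite inE => /eqP p0 d.
  by rewrite inE (psiE d) ?pihomogP// -psi_coef p0 coef0 mul0r.
have I_rel : ~ (forall i : 'I_N, 'X_i \in I).
  move=> /(_ i0); rewrite inE psiX => /eqP/(congr1 (coefp 1)) /=.
  by rewrite coefZ coefX mulr1 coef0; apply/eqP.
exists (Proj I_ideal I_prime I_homog I_rel) => d p pd /=.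
by rewrite inE (psiE d)// mulf_eq0 expf_eq0 polyX_eq0 andbF orbF polyC_eq0.
Qed.

(** The element a distinct from 0 and 1 is the class of a variable 'X_i outside
    the ideal: if 'X_i - 1 were in the ideal, so would its part of degree 0. *)
Lemma residue_point x :
  exists (K : fieldType) (iota : {rmorphism k -> K}) (v : 'I_N -> K),
    [/\ point_of iota v x, exists i, v i != 0 & exists a : K, a != 0 /\ a != 1].
Proof.
have [K [phi phiE]] := residue_field (proj_is_ideal x) (@proj_is_prime _ _ x).
pose iota : {rmorphism k -> K} := phi \o @mpolyC N k.
pose v i := phi 'X_i.
have phi_ev p : phi p = evalp iota v p.
  apply: (@rmorph_mpoly_ext _ _ _ phi (evalp iota v)) => [a|i].
    exact/esym/(evalpC iota).
  exact/esym/(evalpX iota).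
have [i xi] : exists i, 'X_i \notin proj_ideal x.
  apply: contrapT => noi; apply: (@proj_relevant _ _ x) => i.
  by apply: contrapT => /negP xi; apply: noi; exists i.
have vi : v i != 0 by rewrite -phiE.
exists K, iota, v; split; last 2 first.
- by exists i.
- exists (v i); split=> //; apply/eqP => vi1.
  have : 'X_i - 1 \in proj_ideal x.
    by rewrite phiE rmorphB rmorph1 subr_eq0 -/(v i) vi1.
  move=> /(@proj_is_homogeneous _ _ x)/(_ 0%N).
  rewrite pihomogB (pihomog_ne0 (d := 1)) ?dhomogX /= ?mdeg1//.
  rewrite (pihomog_dE (dhomog1 _ _)) phiE sub0r rmorphN oppr_eq0 rmorph1.
  by rewrite oner_eq0.
by move=> d p pd; rewrite phiE phi_ev.
Qed.

End ProjPoints.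

(** * The four shapes of matrices *)

Inductive mxshape := ShapeR | ShapeS | ShapeA | ShapeC.

Definition shape_set (s : mxshape) (n : nat) (K : fieldType) :
    set 'M[{mpoly K[n]}]_3 :=
  match s with
  | ShapeR => shapeR n K
  | ShapeS => shapeS n K
  | ShapeA => shapeA n K
  | ShapeC => shapeC n K
  end.

Definition orbit_closure (s : mxshape) (k : fieldType) (n : nat) : set (PM k n) :=
  closure (Defs.orbit (@shape_set s n)).

(** A shape is encoded as an idempotent linear map, natural in the ring of
    coefficients, so that being of that shape is an equation preserved by ring
    morphisms and so that a matrix of indeterminates yields a generic matrix of
    that shape. *)
Definition to_shape (s : mxshape) (R : zmodType) (m : 'M[R]_3) : 'M[R]_3 :=
  \matrix_(i, j) match s with
  | ShapeR => if i == 2 then 0 else m i j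
  | ShapeS => if (i == 0) || (j == 0) then m i j else 0
  | ShapeA => if (i < j)%N then m i j else if (j < i)%N then - m j i else 0
  | ShapeC => if j == 2 then 0 else m i j
  end.

Definition has_shape s (R : zmodType) (m : 'M[R]_3) : Prop := to_shape s m = m.

Lemma to_shapeK s (R : zmodType) (m : 'M[R]_3) : has_shape s (to_shape s m).
Proof.
apply/matrixP => i j; case: s; rewrite !mxE.
all: by do ?[case: ltngtP => // | case: ifP => //].
Qed.

Lemma map_to_shape s (R S : zmodType) (phi : {additive R -> S}) (m : 'M[R]_3) :
  map_mx phi (to_shape s m) = to_shape s (map_mx phi m).
Proof.
apply/matrixP => i j; case: s; rewrite !mxE;
  do 2?[case: ifP => _]; by rewrite ?raddf0 ?raddfN.
Qed.

Lemma map_has_shape s (R S : zmodType) (phi : {additive R -> S}) (m : 'M[R]_3) :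
  has_shape s m -> has_shape s (map_mx phi m).
Proof. by rewrite /has_shape -map_to_shape => ->. Qed.

Lemma ord3P (P : 'I_3 -> Prop) : P 0 -> P 1 -> P 2 -> forall i, P i.
Proof.
move=> P0 P1 P2 [[|[|[|//]]] lti].
- by rewrite (_ : Ordinal lti = 0) //; apply: val_inj.
- by rewrite (_ : Ordinal lti = 1) //; apply: val_inj.
- by rewrite (_ : Ordinal lti = 2) //; apply: val_inj.
Qed.

Lemma shape_setP s n (K : fieldType) (m : 'M[{mpoly K[n]}]_3) :
  shape_set s m <-> linear_entries m /\ has_shape s m.
Proof.
split=> [|[mlin ms]].
  case: s => -[mlin sh]; split=> //; move: sh.
  - move=> [a [b [c [d [e [f ->]]]]]]; apply/matrixP.
    by apply: ord3P; apply: ord3P; rewrite !mxE.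
  - move=> [a [b [c [d [e ->]]]]]; apply/matrixP.
    by apply: ord3P; apply: ord3P; rewrite !mxE.
  - move=> [a [b [c ->]]]; apply/matrixP.
    by apply: ord3P; apply: ord3P; rewrite !mxE//= opprK.
  - move=> [a [b [c [d [e [f ->]]]]]]; apply/matrixP.
    by apply: ord3P; apply: ord3P; rewrite !mxE.
case: s ms => /matrixP ms; split=> //.
- exists (m 0 0), (m 0 1), (m 0 2), (m 1 0), (m 1 1), (m 1 2); apply/matrixP.
  by apply: ord3P; apply: ord3P; rewrite -ms !mxE.
- exists (m 0 0), (m 0 1), (m 0 2), (m 1 0), (m 2 0); apply/matrixP.
  by apply: ord3P; apply: ord3P; rewrite -ms !mxE.
- exists (m 0 1), (m 2 0), (m 1 2); apply/matrixP.
  by apply: ord3P; apply: ord3P; rewrite -ms !mxE //= -[m 2 0]ms mxE /= opprK.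
- exists (m 0 0), (m 0 1), (m 1 0), (m 1 1), (m 2 0), (m 2 1); apply/matrixP.
  by apply: ord3P; apply: ord3P; rewrite -ms !mxE.
Qed.

(** * Matrices of linear forms as tensors *)

Definition tcoords (R : Type) n (T : 'I_n -> 'M[R]_3)
    (a : 'I_#|coord_idx n|) : R :=
  let: (i, j, l) := enum_val a in T l i j.

Definition tact (R : comNzRingType) n (f g : 'M[R]_3) (T : 'I_n -> 'M[R]_3) :
    'I_n -> 'M[R]_3 :=
  fun l => f *m T l *m g^T.

Definition lform (R : comNzRingType) n (T : 'I_n -> 'M[R]_3) :
    'M[{mpoly R[n]}]_3 :=
  \matrix_(i, j) \sum_l T l i j *: 'X_l.

Definition tensor_of (R : comNzRingType) n (m : 'M[{mpoly R[n]}]_3) :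
    'I_n -> 'M[R]_3 :=
  fun l => map_mx (mcoeff U_(l)) m.

Section Tensors.
Context {n : nat}.

Lemma tcoordsE (R : Type) (T : 'I_n -> 'M[R]_3) i j l :
  tcoords T (enum_rank ((i, j, l) : coord_idx n)) = T l i j.
Proof. by rewrite /tcoords enum_rankK. Qed.

Lemma tcoords_neq0 (R : zmodType) (T : 'I_n -> 'M[R]_3) :
  (exists l, T l != 0) <-> (exists a, tcoords T a != 0).
Proof.
split=> [[l Tl]|[a Ta]].
  have [[i j] Tij] : exists ij, T l ij.1 ij.2 != 0.
    apply: contrapT => T0; case/eqP: Tl; apply/matrixP => i j; rewrite mxE.
    by apply: contrapT => /eqP Tij; apply: T0; exists (i, j).
  by exists (enum_rank ((i, j, l) : coord_idx n)); rewrite tcoordsE.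
move: Ta; rewrite /tcoords; case: (enum_val a) => -[i j] l Tl.
by exists l; apply: contraNneq Tl => ->; rewrite mxE.
Qed.

Lemma map_tact (R S : comNzRingType) (phi : {rmorphism R -> S}) f g
    (T : 'I_n -> 'M[R]_3) l :
  map_mx phi (tact f g T l) =
  tact (map_mx phi f) (map_mx phi g) (fun l => map_mx phi (T l)) l.
Proof. by rewrite /tact !map_mxM -map_trmx. Qed.

Lemma lform_linear (R : comNzRingType) (T : 'I_n -> 'M[R]_3) i j :
  lform T i j \is 1.-homog.
Proof.
rewrite mxE; apply: rpred_sum => l _; apply: dhomogZ.
by rewrite dhomogX /= mdeg1.
Qed.

Lemma lformK (R : comNzRingType) (T : 'I_n -> 'M[R]_3) : tensor_of (lform T) = T.
Proof.
apply/funext => l; apply/matrixP => i j; rewrite !mxE raddf_sum /=.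
rewrite (bigD1 l)//= big1 ?addr0 => [|l' ne]; rewrite mcoeffZ mcoeffXU.
  by rewrite eqxx mulr1.
by rewrite (negbTE ne) mulr0.
Qed.

Lemma tensor_ofK (R : comNzRingType) (m : 'M[{mpoly R[n]}]_3) :
  (forall i j, m i j \is 1.-homog) -> lform (tensor_of m) = m.
Proof.
move=> mlin; apply/matrixP => i j; apply/mpolyP => u.
have [/mdeg1P[l /eqP ->]|u1] := boolP (mdeg u == 1%N).
  have := congr1 (fun T : 'I_n -> 'M[R]_3 => T l i j) (lformK (tensor_of m)).
  by rewrite /tensor_of !mxE.
have zcoef (p : {mpoly R[n]}) : p \is 1.-homog -> p@_u = 0.
  by move=> /dhomog_nemf_coeff; apply.
by rewrite !zcoef // lform_linear.
Qed.

Lemma lformE (R : comNzRingType) (T : 'I_n -> 'M[R]_3) :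
  lform T = \sum_l 'X_l *: map_mx (@mpolyC n R) (T l).
Proof.
apply/matrixP => i j; rewrite mxE summxE; apply: eq_bigr => l _.
by rewrite !mxE -mul_mpolyC mulrC.
Qed.

Lemma lform_act (R : fieldType) f g (T : 'I_n -> 'M[R]_3) :
  lform (tact f g T) = act f g (lform T).
Proof.
rewrite /act !lformE mulmx_sumr mulmx_suml; apply: eq_bigr => l _.
by rewrite -scalemxAr -scalemxAl /tact !map_mxM map_trmx.
Qed.

Lemma lform_has_shape s (R : comNzRingType) (T : 'I_n -> 'M[R]_3) :
  (forall l, has_shape s (T l)) <-> has_shape s (lform T).
Proof.
split=> [Ts|Ts l]; last by rewrite -(lformK T); apply: map_has_shape.
rewrite /has_shape -[LHS]tensor_ofK => [|i j].
  rewrite -{2}(lformK T) ; congr lform; apply/funext => l.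
  have := congr1 (fun T : 'I_n -> 'M[R]_3 => T l) (lformK T).
  by rewrite /tensor_of map_to_shape => ->; apply: Ts.
by case: s {Ts}; rewrite mxE; do ?[case: ifP => _];
  rewrite ?rpred0 ?rpredN ?lform_linear.
Qed.

Lemma coords_lform (K : fieldType) (T : 'I_n -> 'M[K]_3) :
  coords (lform T) = tcoords T.
Proof.
apply/funext => a; rewrite -[in RHS](lformK T) /coords /tcoords.
by case: (enum_val a) => -[i j] l; rewrite /tensor_of [in RHS]mxE.
Qed.

Lemma lform0P (K : fieldType) (T : 'I_n -> 'M[K]_3) :
  lform T != 0 <-> exists l, T l != 0.
Proof.
split=> [T0|[l Tl]]; last first.
  by apply: contraNneq Tl => T0; rewrite -(lformK T) T0 /tensor_of map_mx0.
apply: contrapT => noT; case/eqP: T0; rewrite lformE big1 // => l _.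
have -> : T l = 0 by apply: contrapT => /eqP Tl; apply: noT; exists l.
by rewrite map_mx0 scaler0.
Qed.

Lemma orbitP s (k : fieldType) (x : PM k n) :
  Defs.orbit (@shape_set s n) x <->
  exists (K : fieldType) (iota : {rmorphism k -> K}) (f g : 'M[K]_3)
      (T : 'I_n -> 'M[K]_3),
    [/\ f \in unitmx, g \in unitmx, forall l, has_shape s (T l),
        exists l, T l != 0 & point_of iota (tcoords (tact f g T)) x].
Proof.
split=> [|] [K [iota [f [g]]]].
  move=> [m [fU gU /shape_setP[mlin ms] m0]].
  rewrite -(tensor_ofK mlin) -lform_act coords_lform => Tx.
  exists K, iota, f, g, (tensor_of m); split=> //.
    by apply/lform_has_shape; rewrite tensor_ofK.
  by apply/lform0P; rewrite tensor_ofK.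
move=> [T [fU gU Ts T0 Tx]]; exists K, iota, f, g, (lform T); split=> //.
- by apply/shape_setP; split; [exact: lform_linear | exact/lform_has_shape].
- exact/lform0P.
- by rewrite -lform_act coords_lform.
Qed.

End Tensors.

(** * The determinant of the generic matrix *)

(** P d p stands for the assertion that p is of degree d, for any notion of
    degree: it is used for the forms in the x_l and for the forms in the
    coordinates of the space of matrices. *)
Lemma det_graded (R : comNzRingType) (P : nat -> R -> Prop) m d (A : 'M[R]_m) :
  P 0%N 1 -> (forall e, P e 0) -> (forall e p, P e p -> P e (- p)) ->
  (forall e p q, P e p -> P e q -> P e (p + q)) ->
  (forall e1 e2 p q, P e1 p -> P e2 q -> P (e1 + e2)%N (p * q)) ->
  (forall i j, P d (A i j)) -> P (m * d)%N (\det A).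
Proof.
move=> P1 P0 PN PD PM PA; rewrite /determinant.
elim/big_rec: _ => [//|s p _ Pp]; apply: (PD) => //.
suff Pprod : P (m * d)%N (\prod_i A i (perm.fun_of_perm s i)).
  by rewrite mulr_sign; case: ifP => _ //; apply: PN.
rewrite -[m in (m * d)%N]card_ord -sum_nat_const.
by apply: (big_rec2 P) => // i p' e _; apply: PM.
Qed.

Lemma det_homog (R : comNzRingType) n m d (A : 'M[{mpoly R[n]}]_m) :
  (forall i j, A i j \is d.-homog) -> \det A \is (m * d).-homog.
Proof.
apply: (@det_graded _ (fun e p => p \is e.-homog)) => [|e|e p|e p q|e1 e2 p q].
- exact: dhomog1.
- exact: dhomog0.
- by rewrite dhomogN.
- exact: dhomogD.
- exact: dhomogM.
Qed.

Lemma det_coefs_homog (R : comNzRingType) N n m d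
    (A : 'M[{mpoly {mpoly R[N]}[n]}]_m) :
  (forall i j u, (A i j)@_u \is d.-homog) ->
  forall u, (\det A)@_u \is (m * d).-homog.
Proof.
apply: (@det_graded _ (fun e p => forall u, p@_u \is e.-homog))
  => [u|e u|e p pe u|e p q pe qe u|e1 e2 p q pe qe u].
- by rewrite mcoeff1; case: (u == _); rewrite ?dhomog1 ?dhomog0.
- by rewrite mcoeff0 dhomog0.
- by rewrite mcoeffN dhomogN.
- by rewrite mcoeffD dhomogD.
- by rewrite mcoeffM; apply: rpred_sum => w _; apply: dhomogM.
Qed.

Lemma generic_matrixE (k : fieldType) n (K : fieldType)
    (iota : {rmorphism k -> K}) (T : 'I_n -> 'M[K]_3) :
  map_mx (map_mpoly (evalp iota (tcoords T))) (generic_matrix k n) = lform T.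
Proof.
apply/matrixP => i j; rewrite !mxE rmorph_sum; apply: eq_bigr => l _ /=.
rewrite map_mpolyZ map_mpolyX; congr (_ *: _); rewrite -(tcoordsE T).
exact: evalpX.
Qed.

Lemma generic_matrix_coef_homog (k : fieldType) n i j u :
  (generic_matrix k n i j)@_u \is 1.-homog.
Proof.
rewrite mxE raddf_sum; apply: rpred_sum => l _ /=.
rewrite mcoeffZ mcoeffX mulr_natr; apply: rpredMn.
by rewrite dhomogX /= mdeg1.
Qed.

(** The generic matrix specializes to the matrix of linear forms of T.  The
    coefficients of its determinant are forms of degree 3 in the coordinates,
    so that their membership in the ideal of x can be tested at T; and det has
    only coefficients of degree 3 in the x_l, so that testing those suffices. *)
Lemma singular_locusP (k : fieldType) n (K : fieldType)
    (iota : {rmorphism k -> K}) (T : 'I_n -> 'M[K]_3) (x : PM k n) :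
  point_of iota (tcoords T) x -> singular_locus k n x <-> \det (lform T) = 0.
Proof.
move=> Tx.
have coefE u : ((\det (generic_matrix k n))@_u \in proj_ideal x) =
               ((\det (lform T))@_u == 0).
  rewrite (Tx 3) -?(generic_matrixE iota) ?det_map_mx ?mcoeff_map_mpoly//.
  exact/(det_coefs_homog (d := 1))/generic_matrix_coef_homog.
split=> [Dx|D0 _ [u _ <-]]; last by rewrite coefE D0 mcoeff0.
apply/mpolyP => u; rewrite mcoeff0.
have [u3|u3] := eqVneq (mdeg u) 3%N.
  by apply/eqP; rewrite -coefE; apply: Dx; exists u.
have /dhomog_nemf_coeff : \det (lform T) \is (3 * 1).-homog.
  exact/det_homog/lform_linear.
exact.
Qed.

Lemma det_lform0 (K : fieldType) n (T : 'I_n -> 'M[K]_3) (t : 'I_n -> K) :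
  \det (lform T) = 0 -> \det (\sum_l t l *: T l) = 0.
Proof.
move=> /(congr1 (meval t)); rewrite rmorph0 -det_map_mx => <-; congr (\det _).
apply/matrixP => i j; rewrite summxE !mxE rmorph_sum; apply: eq_bigr => l _ /=.
by rewrite mxE mevalZ mevalXU mulrC.
Qed.

Lemma det_act (K : fieldType) n f g (m : 'M[{mpoly K[n]}]_3) :
  \det m = 0 -> \det (act f g m) = 0.
Proof. by move=> m0; rewrite /act !det_mulmx m0 mulr0 mul0r. Qed.

(** * Polynomial identities in commutative rings *)

(** The operations are renamed, on a type with a fixed head symbol, because the
    same operation reached through different paths of the hierarchy of
    algebraic structures gives terms that the ring tactic does not identify. *)
Section ComRingTactic.
Context (R : comNzRingType).

Definition comring_sort : Type := R.
Definition comring_add (x y : comring_sort) : comring_sort := (x : R) + y.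
Definition comring_mul (x y : comring_sort) : comring_sort := (x : R) * y.
Definition comring_opp (x : comring_sort) : comring_sort := - (x : R).
Definition comring_sub (x y : comring_sort) : comring_sort := (x : R) - y.
Definition comring0 : comring_sort := 0 :> R.
Definition comring1 : comring_sort := 1 :> R.

Lemma comring_theory : ring_theory comring0 comring1
  comring_add comring_mul comring_sub comring_opp eq.
Proof.
split=> *; rewrite /comring_add /comring_mul /comring_sub /comring_opp.
all: rewrite ?(add0r, addrA, mul1r, mulrA, mulrDl, subrr) //.
all: by [apply: addrC | apply: mulrC].
Qed.

End ComRingTactic.

Ltac to_comring R t :=
  lazymatch t with
  | @Algebra.add _ ?a ?b =>
      let a := to_comring R a in let b := to_comring R b in
      constr:(@comring_add R a b)
  | @GRing.mul _ ?a ?b =>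
      let a := to_comring R a in let b := to_comring R b in
      constr:(@comring_mul R a b)
  | @Algebra.opp _ ?a => let a := to_comring R a in constr:(@comring_opp R a)
  | @Algebra.zero _ => constr:(@comring0 R)
  | @GRing.one _ => constr:(@comring1 R)
  | _ => constr:(t : comring_sort R)
  end.

Ltac comring_for R :=
  lazymatch goal with
  | |- @eq _ ?a ?b =>
      let a := to_comring R a in let b := to_comring R b in
      change (@eq (comring_sort R) a b); ring
  end.

Section Det3.
Context (R : comNzRingType).

Add Ring comring_ring : (comring_theory R).

Ltac comring := comring_for R.

Lemma det3E (A : 'M[R]_3) :
  \det A = A 0 0 * (A 1 1 * A 2 2 - A 1 2 * A 2 1)
         - A 0 1 * (A 1 0 * A 2 2 - A 1 2 * A 2 0)
         + A 0 2 * (A 1 0 * A 2 1 - A 1 1 * A 2 0).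
Proof.
rewrite (expand_det_row _ ord0) !big_ord_recl big_ord0 addr0 /cofactor.
rewrite !(expand_det_row _ ord0) !big_ord_recl !big_ord0 !addr0 /cofactor.
rewrite !det_mx11 !mxE.
have [a AE] : exists a : nat -> nat -> R, forall i j, A i j = a i j.
  by exists (fun i j => A (inord i) (inord j)) => i j; rewrite !inord_val.
rewrite !AE /=.
have mod3 : ((1 %% 3)%N = 1%N) * (((1 + 1) %% 3)%N = 2%N) by [].
rewrite !(exprS, expr0) /bump /= !mod3 !(add0n, addn0, add1n).
comring.
Qed.

Lemma det_has_shape s (m : 'M[R]_3) : has_shape s m -> \det m = 0.
Proof.
rewrite /has_shape => <-; rewrite det3E; case: s; rewrite !mxE /=; comring.
Qed.

End Det3.

(** * Linear families of singular matrices *)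

Section Classification.
Context (K : fieldType) (V : lmodType K).

Add Ring field_ring : (comring_theory K).
Ltac comring := comring_for (K : comNzRingType).

Definition is_form (L : V -> K) :=
  forall a x y, L (a *: x + y) = a * L x + L y.

Lemma formD L x y : is_form L -> L (x + y) = L x + L y.
Proof. by move=> Ll; rewrite -[x]scale1r Ll scale1r mul1r. Qed.

Lemma form0 L : is_form L -> L 0 = 0.
Proof. by move=> Ll; apply: (addIr (L 0)); rewrite -formD// !add0r. Qed.

Lemma formZ L a x : is_form L -> L (a *: x) = a * L x.
Proof. by move=> Ll; rewrite -[a *: x]addr0 Ll form0 // addr0. Qed.

Lemma form_neq0 (L : V -> K) : ~ (forall t, L t = 0) -> exists t, L t != 0.
Proof.
move=> L0; apply: contrapT => noL; apply: L0 => t.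
by apply: contrapT => /eqP Lt; apply: noL; exists t.
Qed.

Lemma form_mul2 L1 L2 : is_form L1 -> is_form L2 ->
  (forall t, L1 t * L2 t = 0) -> (forall t, L1 t = 0) \/ (forall t, L2 t = 0).
Proof.
move=> l1 l2 L12; apply: contrapT => /not_orP[/form_neq0[a La] /form_neq0[b Lb]].
have L2a : L2 a = 0 by move/eqP: (L12 a); rewrite mulf_eq0 (negbTE La) => /eqP.
have L1b : L1 b = 0.
  by move/eqP: (L12 b); rewrite mulf_eq0 (negbTE Lb) orbF => /eqP.
move/eqP: (L12 (a + b)); rewrite !formD// L2a L1b addr0 add0r mulf_eq0.
by rewrite (negbTE La) (negbTE Lb).
Qed.

Context (alpha : K) (alpha0 : alpha != 0) (alpha1 : alpha != 1).

(** The zero set of a linear form that is not zero is a hyperplane, and a vector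
    space over a field with at least three elements is not the union of three
    hyperplanes.  The form L3 is constant on the line of direction a, where
    L1 L2 is a quadratic polynomial that would vanish at 0, 1 and alpha. *)
Lemma form_mul3 L1 L2 L3 : is_form L1 -> is_form L2 -> is_form L3 ->
  (forall t, L1 t * L2 t * L3 t = 0) ->
  [\/ forall t, L1 t = 0, forall t, L2 t = 0 | forall t, L3 t = 0].
Proof.
move=> l1 l2 l3 L123.
have [L12|/form_neq0[a La]] := pselect (forall t, L1 t * L2 t = 0).
  by case: (form_mul2 l1 l2 L12) => ?; [constructor 1 | constructor 2].
have [L30|/form_neq0[b Lb]] := pselect (forall t, L3 t = 0).
  by constructor 3.
move: La; rewrite mulf_eq0 negb_or => /andP[L1a L2a].
have L3a : L3 a = 0.
  move/eqP: (L123 a); rewrite !mulf_eq0 (negbTE L1a) (negbTE L2a).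
  by move/eqP.
have quad c : (L1 b / L1 a + c == 0) || (L2 b / L2 a + c == 0).
  move/eqP: (L123 (c *: a + b)); rewrite l1 l2 l3 L3a mulr0 add0r.
  rewrite !mulf_eq0 (negbTE Lb) orbF => /orP[] /eqP e; apply/orP; [left|right].
    rewrite -[c](mulfK L1a) -mulrDl addrC e mul0r //.
  by rewrite -[c](mulfK L2a) -mulrDl addrC e mul0r.
exfalso; move: quad; set p := L1 b / L1 a; set q := L2 b / L2 a => quad.
have root2 (r : K) : (r == 0) || (r + 1 == 0) -> (r + alpha == 0) = false.
  case/orP=> [/eqP->|]; first by rewrite add0r (negbTE alpha0).
  rewrite addr_eq0 => /eqP->; rewrite addrC subr_eq0; exact/negbTE.
have root1 (r : K) : (r == 0) -> (r + 1 == 0) = false.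
  by move/eqP->; rewrite add0r oner_eq0.
move: (quad 0) (quad 1) (quad alpha); rewrite !addr0.
case/orP => e /orP[] e1.
- by rewrite root1 in e1.
- by rewrite !root2 ?e ?e1 ?orbT.
- by rewrite !root2 ?e ?e1 ?orbT.
- by rewrite root1 in e1.
Qed.

Definition is_family (M : V -> 'M[K]_3) :=
  forall a x y, M (a *: x + y) = a *: M x + M y.

Definition has_normal_shape (M : V -> 'M[K]_3) :=
  exists s (f g : 'M[K]_3),
    [/\ f \in unitmx, g \in unitmx & forall t, has_shape s (f *m M t *m g)].

Lemma has_normal_shape_equiv M f g : f \in unitmx -> g \in unitmx ->
  has_normal_shape (fun t => f *m M t *m g) -> has_normal_shape M.
Proof.
move=> fU gU [s [f' [g' [f'U g'U sh]]]]; exists s, (f' *m f), (g *m g').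
by split=> [||t]; rewrite ?unitmx_mul ?fU ?gU ?f'U ?g'U//= -!mulmxA mulmxA
  ; move: (sh t); rewrite !mulmxA.
Qed.

Lemma family_entry M i j : is_family M -> is_form (fun t => M t i j).
Proof. by move=> Mlin a x y; rewrite Mlin !mxE. Qed.

Lemma is_family_equiv M f g : is_family M -> is_family (fun t => f *m M t *m g).
Proof.
by move=> Mlin a x y; rewrite Mlin mulmxDr mulmxDl -scalemxAr -scalemxAl.
Qed.

Lemma mulmx3E (A B : 'M[K]_3) i j :
  (A *m B) i j = A i 0 * B 0 j + A i 1 * B 1 j + A i 2 * B 2 j.
Proof.
rewrite mxE !big_ord_recl big_ord0 addr0 addrA.
congr (_ + A i _ * B _ j + A i _ * B _ j); exact: val_inj.
Qed.

(** The instance for a field of [det3E], whose entries have the type that the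
    ring tactic finds in goals about matrices over K. *)
Lemma det3F (A : 'M[K]_3) :
  \det A = A 0 0 * (A 1 1 * A 2 2 - A 1 2 * A 2 1)
         - A 0 1 * (A 1 0 * A 2 2 - A 1 2 * A 2 0)
         + A 0 2 * (A 1 0 * A 2 1 - A 1 1 * A 2 0).
Proof. exact: det3E. Qed.

Definition mat3 (s : seq (seq K)) : 'M[K]_3 :=
  \matrix_(i, j) nth 0 (nth [::] s i) j.

Lemma mat3_unit s c : \det (mat3 s) = c -> c != 0 -> mat3 s \in unitmx.
Proof. by move=> dets c0; rewrite unitmxE dets unitfE. Qed.

(** In this lemma and the next three, M_22 = 0, and b, c denote the column
    (M_02, M_12) and the row (M_20, M_21), with c b = 0.  If b_0 = 0, then
    b_1 c_1 = 0: either b = 0, and the last column is zero, or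
    det M = M_01 b_1 c_0, so that one of the three forms is zero. *)
Lemma normal_shape_b0_eq0 M : is_family M ->
  (forall t, M t 0 2 = 0) -> (forall t, M t 2 2 = 0) ->
  (forall t, M t 1 2 * M t 2 1 = 0) -> (forall t, \det (M t) = 0) ->
  has_normal_shape M.
Proof.
move=> Mlin M02 M22 M1221 detM.
have lin i j := family_entry i j Mlin.
case: (form_mul2 (lin _ _) (lin _ _) M1221) => [M12|M21].
  exists ShapeC, 1%:M, 1%:M; split; rewrite ?unitmx1// => t.
  rewrite mulmx1 mul1mx; apply/matrixP; apply: ord3P; apply: ord3P;
    by rewrite !mxE ?M02 ?M12 ?M22.
have : forall t, M t 0 1 * M t 1 2 * M t 2 0 = 0.
  move=> t; rewrite -[RHS](detM t) det3F M02 M22 M21. comring.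
case/form_mul3 => // [M01|M12|M20].
- pose f := mat3 [:: [:: 0; 1; 0]; [:: 1; 0; 0]; [:: 0; 0; 1]].
  exists ShapeS, f, 1%:M; split; rewrite ?unitmx1//.
    by apply: (@mat3_unit _ (-1)); rewrite ?oppr_eq0 ?oner_neq0// det3F !mxE /=;
      comring.
  move=> t; rewrite mulmx1; apply/matrixP; apply: ord3P; apply: ord3P;
    rewrite mxE /= ?mulmx3E ?mxE /= ?M01 ?M02 ?M21 ?M22; comring.
- exists ShapeC, 1%:M, 1%:M; split; rewrite ?unitmx1// => t.
  rewrite mulmx1 mul1mx; apply/matrixP; apply: ord3P; apply: ord3P;
    by rewrite !mxE ?M02 ?M12 ?M22.
- exists ShapeR, 1%:M, 1%:M; split; rewrite ?unitmx1// => t.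
  rewrite mulmx1 mul1mx; apply/matrixP; apply: ord3P; apply: ord3P;
    by rewrite !mxE ?M20 ?M21 ?M22.
Qed.

(** Exchanging the first two rows and the first two columns. *)
Lemma normal_shape_b1_eq0 M : is_family M ->
  (forall t, M t 1 2 = 0) -> (forall t, M t 2 2 = 0) ->
  (forall t, M t 0 2 * M t 2 0 = 0) -> (forall t, \det (M t) = 0) ->
  has_normal_shape M.
Proof.
move=> Mlin M12 M22 M0220 detM.
pose f := mat3 [:: [:: 0; 1; 0]; [:: 1; 0; 0]; [:: 0; 0; 1]].
have fU : f \in unitmx.
  apply: (@mat3_unit _ (-1)); rewrite ?oppr_eq0 ?oner_neq0// det3F !mxE /=.
  comring.
apply: (has_normal_shape_equiv fU fU); apply: normal_shape_b0_eq0.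
- exact: is_family_equiv.
- by move=> t; rewrite !mulmx3E !mxE /= M12 M22; comring.
- by move=> t; rewrite !mulmx3E !mxE /= M22; comring.
- by move=> t; rewrite -[RHS](M0220 t) !mulmx3E !mxE /= M12 M22; comring.
- by move=> t; rewrite !det_mulmx detM mulr0 mul0r.
Qed.

(** The vectors s1 and s2 are dual to the forms b_0 and b_1.  Polarizing
    c b = 0 at s1 and at s2 gives c = lambda (- b_1, b_0).  If lambda is not
    zero, det M = 0 reads
      b_0 b_1 (M_11 - M_00) = M_01 b_1^2 - M_10 b_0^2.
    So M_10 vanishes on the kernel of b_1 and M_01 on the kernel of b_0, that
    is M_10 = mu b_1 and M_01 = nu b_0, and then
    M_11 - M_00 = nu b_1 - mu b_0.  Subtracting mu and nu times the last column
    from the first two leaves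
      beta 0 b_0 / 0 beta b_1 / - lambda b_1, lambda b_0, 0,
    which is alternating up to a signed exchange of the first two columns and
    a scaling of the last row. *)
Lemma normal_shape_b_free M s1 s2 : is_family M ->
  (forall t, M t 2 2 = 0) ->
  (forall t, M t 0 2 * M t 2 0 + M t 1 2 * M t 2 1 = 0) ->
  (forall t, \det (M t) = 0) ->
  M s1 0 2 = 1 -> M s1 1 2 = 0 -> M s2 0 2 = 0 -> M s2 1 2 = 1 ->
  has_normal_shape M.
Proof.
move=> Mlin M22 Mcb detM M02s1 M12s1 M02s2 M12s2.
have lin i j := family_entry i j Mlin.
have MD i j x y : M (x + y) i j = M x i j + M y i j by rewrite (formD _ _ (lin i j)).
have MZ i j c x : M (c *: x) i j = c * M x i j by rewrite (formZ _ _ (lin i j)).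
pose lam := M s1 2 1.
have M20s1 : M s1 2 0 = 0.
  by move: (Mcb s1); rewrite M02s1 M12s1 mul1r mul0r addr0.
have M21s2 : M s2 2 1 = 0.
  by move: (Mcb s2); rewrite M02s2 M12s2 mul1r mul0r add0r.
have M20 t : M t 2 0 = - (lam * M t 1 2).
  apply/eqP; rewrite -addr_eq0; apply/eqP.
  have := congr2 (fun a b => a - b) (Mcb (t + s1)) (Mcb t).
  rewrite /= !MD M20s1 M02s1 M12s1 -/lam subrr addr0 => <-; comring.
have M20s2 : M s2 2 0 = - lam by rewrite M20 M12s2 mulr1.
have M21 t : M t 2 1 = lam * M t 0 2.
  apply/eqP; rewrite -subr_eq0; apply/eqP.
  have := congr2 (fun a b => a - b) (Mcb (t + s2)) (Mcb t).
  rewrite /= !MD M21s2 M02s2 M12s2 M20s2 subrr !addr0 => <-; comring.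
have [lam0|lam0] := eqVneq lam 0.
  exists ShapeR, 1%:M, 1%:M; split; rewrite ?unitmx1// => t.
  rewrite mulmx1 mul1mx; apply/matrixP; apply: ord3P; apply: ord3P;
    by rewrite !mxE ?M20 ?M21 ?M22 ?lam0 ?mul0r ?oppr0.
have cubic t : M t 0 2 * M t 1 2 * (M t 1 1 - M t 0 0)
    = M t 0 1 * M t 1 2 * M t 1 2 - M t 0 2 * M t 0 2 * M t 1 0.
  apply: (mulfI lam0); apply/eqP; rewrite -subr_eq0; apply/eqP.
  rewrite -[RHS](detM t) det3F M20 M21 M22; comring.
pose mu := M s2 1 0; pose nu := M s1 0 1.
have M10 t : M t 1 0 = M t 1 2 * mu.
  have vanish u : M u 0 2 = 1 -> M u 1 2 = 0 -> M u 1 0 = 0.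
    move=> u02 u12; move: (cubic u); rewrite u02 u12 => /esym/eqP.
    by rewrite !mulr0 mul0r !mul1r sub0r oppr_eq0 => /eqP.
  have M10s1 := vanish s1 M02s1 M12s1.
  pose u := t - M t 1 2 *: s2 + (1 - M t 0 2) *: s1.
  have uE i j : M u i j = M t i j - M t 1 2 * M s2 i j + (1 - M t 0 2) * M s1 i j.
    by rewrite /u -scaleNr !MD !MZ mulNr.
  have := vanish u; rewrite !uE M02s1 M02s2 M12s1 M12s2 M10s1 -/mu.
  rewrite !mulr0 !mulr1 subr0 !addr0 subrr [M t 0 2 + _]addrC subrK.
  by move=> /(_ erefl erefl)/eqP; rewrite subr_eq0 => /eqP.
have M01 t : M t 0 1 = M t 0 2 * nu.
  have vanish u : M u 0 2 = 0 -> M u 1 2 = 1 -> M u 0 1 = 0.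
    move=> u02 u12; move: (cubic u); rewrite u02 u12 => /esym/eqP.
    by rewrite !mul0r !mulr1 subr0 => /eqP.
  have M01s2 := vanish s2 M02s2 M12s2.
  pose u := t - M t 0 2 *: s1 + (1 - M t 1 2) *: s2.
  have uE i j : M u i j = M t i j - M t 0 2 * M s1 i j + (1 - M t 1 2) * M s2 i j.
    by rewrite /u -scaleNr !MD !MZ mulNr.
  have := vanish u; rewrite !uE M02s1 M02s2 M12s1 M12s2 M01s2 -/nu.
  rewrite !mulr0 !mulr1 subr0 !addr0 subrr [M t 1 2 + _]addrC subrK.
  by move=> /(_ erefl erefl)/eqP; rewrite subr_eq0 => /eqP.
have diag : forall t, M t 1 1 - M t 0 0 - (nu * M t 1 2 - mu * M t 0 2) = 0.
  have Mdiag t : M t 0 2 * M t 1 2 *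
      (M t 1 1 - M t 0 0 - (nu * M t 1 2 - mu * M t 0 2)) = 0.
    rewrite mulrBr cubic M10 M01; comring.
  have L_form : is_form
      (fun t => M t 1 1 - M t 0 0 - (nu * M t 1 2 - mu * M t 0 2)).
    by move=> c x y; rewrite !MD !MZ; comring.
  case: (form_mul3 (lin 0 2) (lin 1 2) L_form Mdiag) => // [M02|M12].
    by move/eqP: M02s1; rewrite M02 eq_sym oner_eq0.
  by move/eqP: M12s2; rewrite M12 eq_sym oner_eq0.
pose f := mat3 [:: [:: 1; 0; 0]; [:: 0; 1; 0]; [:: 0; 0; - lam^-1]].
pose g := mat3 [:: [:: 0; -1; 0]; [:: 1; 0; 0]; [:: - nu; mu; 1]].
have fU : f \in unitmx.
  apply: (@mat3_unit _ (- lam^-1)); rewrite ?oppr_eq0 ?invr_eq0//.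
  by rewrite det3F !mxE /=; comring.
have gU : g \in unitmx.
  by apply: (@mat3_unit _ 1); rewrite ?oner_neq0// det3F !mxE /=; comring.
exists ShapeA, f, g; split=> // t; set N := f *m M t *m g.
have N00 : N 0 0 = 0 by rewrite /N !mulmx3E !mxE /= M01; comring.
have N11 : N 1 1 = 0 by rewrite /N !mulmx3E !mxE /= M10; comring.
have N22 : N 2 2 = 0 by rewrite /N !mulmx3E !mxE /= M22; comring.
have N10 : N 1 0 = - N 0 1.
  apply/eqP; rewrite -addr_eq0 -[X in _ == X](diag t); apply/eqP.
  by rewrite /N !mulmx3E !mxE /=; comring.
have N20 : N 2 0 = - N 0 2.
  transitivity (- (lam^-1 * lam * M t 0 2)).
    by rewrite /N !mulmx3E !mxE /= M20 M21 M22; comring.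
  by rewrite mulVf// /N !mulmx3E !mxE /=; comring.
have N21 : N 2 1 = - N 1 2.
  transitivity (- (lam^-1 * lam * M t 1 2)).
    by rewrite /N !mulmx3E !mxE /= M20 M21 M22; comring.
  by rewrite mulVf// /N !mulmx3E !mxE /=; comring.
apply/matrixP; apply: ord3P; apply: ord3P;
  by rewrite mxE /= ?N00 ?N11 ?N22 ?N10 ?N20 ?N21.
Qed.

(** If b_0 is not zero, take s1 with b_0 (s1) = 1; a conjugation by a
    transvection, which preserves c b, achieves b_1 (s1) = 0.  Then b_1 is
    either zero or independent of b_0. *)
Lemma normal_shape_corner M : is_family M ->
  (forall t, M t 2 2 = 0) ->
  (forall t, M t 0 2 * M t 2 0 + M t 1 2 * M t 2 1 = 0) ->
  (forall t, \det (M t) = 0) -> has_normal_shape M.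
Proof.
move=> Mlin M22 Mcb detM.
have [M02|/form_neq0[s Ms]] := pselect (forall t, M t 0 2 = 0).
  apply: normal_shape_b0_eq0 => // t.
  by rewrite -[RHS](Mcb t) M02 mul0r add0r.
have {s Ms} [s1 Ms1] : exists s1, M s1 0 2 = 1.
  by exists ((M s 0 2)^-1 *: s); rewrite (formZ _ _ (family_entry _ _ Mlin)) mulVf.
pose y := M s1 1 2.
pose f := mat3 [:: [:: 1; 0; 0]; [:: - y; 1; 0]; [:: 0; 0; 1]].
pose g := mat3 [:: [:: 1; 0; 0]; [:: y; 1; 0]; [:: 0; 0; 1]].
have fU : f \in unitmx.
  by apply: (@mat3_unit _ 1); rewrite ?oner_neq0// det3F !mxE /=; comring.
have gU : g \in unitmx.
  by apply: (@mat3_unit _ 1); rewrite ?oner_neq0// det3F !mxE /=; comring.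
apply: (has_normal_shape_equiv fU gU); set N := fun t => _.
have Nlin : is_family N by apply: is_family_equiv.
have N22 t : N t 2 2 = 0 by rewrite /N !mulmx3E !mxE /= M22; comring.
have Ncb t : N t 0 2 * N t 2 0 + N t 1 2 * N t 2 1 = 0.
  by rewrite -[RHS](Mcb t) /N !mulmx3E !mxE /= M22; comring.
have detN t : \det (N t) = 0 by rewrite !det_mulmx detM mulr0 mul0r.
have N02s1 : N s1 0 2 = 1 by rewrite /N !mulmx3E !mxE /= Ms1 -/y; comring.
have N12s1 : N s1 1 2 = 0 by rewrite /N !mulmx3E !mxE /= Ms1 -/y; comring.
have [N12|/form_neq0[s Ns]] := pselect (forall t, N t 1 2 = 0).
  apply: normal_shape_b1_eq0 => // t.
  by rewrite -[RHS](Ncb t) N12 mul0r addr0.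
have lin i j := family_entry i j Nlin.
apply: (@normal_shape_b_free _ s1
  ((N s 1 2)^-1 *: (s - N s 0 2 *: s1))) => //.
- rewrite (formZ _ _ (lin _ _)) -scaleNr (formD _ _ (lin _ _)).
  by rewrite (formZ _ _ (lin _ _)) N02s1 mulr1 subrr mulr0.
- rewrite (formZ _ _ (lin _ _)) -scaleNr (formD _ _ (lin _ _)).
  by rewrite (formZ _ _ (lin _ _)) N12s1 mulr0 addr0 mulVf.
Qed.

Lemma rank1_minor (A : 'M[K]_3) i j k l :
  (\rank A <= 1)%N -> A i j * A k l = A i l * A k j.
Proof.
rewrite leq_eqVlt ltnS leqn0 => /orP[/eqP r1|]; last first.
  by rewrite mxrank_eq0 => /eqP->; rewrite !mxE !mul0r.
pose u := col_ebase A; pose v := row_ebase A.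
have AE a b : A a b = u a 0 * v 0 b.
  rewrite -[in LHS](mulmx_ebase A) r1 !mulmx3E !mxE /= ?(mulr0n, mulr1n) -/u -/v.
  comring.
rewrite !AE; comring.
Qed.

(** In rank 2, det (c J + M(t)) - det M(t) with J = diag(1, 1, 0) is
    c^2 M_22 + c (M_00 M_22 + M_11 M_22 - c b); its vanishing at c = 1 and
    c = alpha kills both coefficients. *)
Lemma normal_shape_singular M : is_family M -> (forall t, \det (M t) = 0) ->
  has_normal_shape M.
Proof.
move=> Mlin detM.
have rk t : (\rank (M t) <= 2)%N.
  rewrite -ltnS ltn_neqAle rank_leq_row andbT; apply/negP => /eqP rt.
  have : M t \in unitmx by rewrite -row_free_unit -row_leq_rank rt.
  by rewrite unitmxE detM unitr0.
have famE (f g : 'M[K]_3) : is_family (fun t => f *m M t *m g).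
  by move=> a x y; rewrite Mlin mulmxDr mulmxDl -scalemxAr -scalemxAl.
have detE (f g : 'M[K]_3) t : \det (f *m M t *m g) = 0.
  by rewrite !det_mulmx detM mulr0 mul0r.
have reduce r : (exists t, \rank (M t) = r) -> exists t f g,
    [/\ f \in unitmx, g \in unitmx & f *m M t *m g = pid_mx r].
  move=> [t rt]; exists t, (invmx (col_ebase (M t))), (invmx (row_ebase (M t))).
  split; rewrite ?unitmx_inv ?col_ebase_unit ?row_ebase_unit//.
  rewrite -{2}(mulmx_ebase (M t)) rt -!mulmxA mulKmx ?col_ebase_unit//.
  by rewrite mulmxV ?row_ebase_unit// mulmx1.
have [/reduce[s [f [g [fU gU Ns]]]]|no2] := pselect (exists t, \rank (M t) = 2).
  apply: (has_normal_shape_equiv fU gU).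
  pose N (t : V) : 'M[K]_3 := f *m M t *m g; rewrite -/(N s) in Ns *.
  have Nlin : is_family N := famE f g.
  have detN t : \det (N t) = 0 := detE f g t.
  rewrite -/N; move: N Ns Nlin detN => N Ns Nlin detN.
  have ND i j x y : N (x + y) i j = N x i j + N y i j.
    by rewrite (formD _ _ (family_entry _ _ Nlin)).
  have NZ i j c x : N (c *: x) i j = c * N x i j.
    by rewrite (formZ _ _ (family_entry _ _ Nlin)).
  have expand c t : c * (c * N t 2 2 + (N t 0 0 * N t 2 2 + N t 1 1 * N t 2 2
      - N t 0 2 * N t 2 0 - N t 1 2 * N t 2 1)) = 0.
    have := congr2 (fun a b => a - b) (detN (c *: s + t)) (detN t).
    rewrite /= subrr => <-.
    by rewrite !det3F !ND !NZ Ns !mxE /= ?(mulr0n, mulr1n); comring.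
  have N22 t : N t 2 2 = 0.
    have := congr2 (fun a b => a - alpha * b) (expand alpha t) (expand 1 t).
    rewrite /= mulr0 subrr => e; apply/eqP.
    have : alpha * (alpha - 1) * N t 2 2 == 0 by apply/eqP; rewrite -e; comring.
    by rewrite !mulf_eq0 (negbTE alpha0) subr_eq0 (negbTE alpha1).
  apply: normal_shape_corner => // t.
  have := congr1 -%R (expand 1 t); rewrite oppr0 N22 => <-; comring.
have [/reduce[s [f [g [fU gU Ns]]]]|no1] := pselect (exists t, \rank (M t) = 1%N).
  pose N (t : V) : 'M[K]_3 := f *m M t *m g; rewrite -/(N s) in Ns *.
  have Nlin : is_family N := famE f g.
  have rkN t : (\rank (N t) <= 1)%N.
    apply: leq_trans (mxrankM_maxl _ _) _; apply: leq_trans (mxrankM_maxr _ _) _.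
    rewrite -ltnS ltn_neqAle rk andbT; apply/eqP => rt.
    by apply: no2; exists t.
  apply: (has_normal_shape_equiv fU gU).
  rewrite -/N; move: N Ns Nlin rkN => N Ns Nlin rkN.
  have ND i j x y : N (x + y) i j = N x i j + N y i j.
    by rewrite (formD _ _ (family_entry _ _ Nlin)).
  have Nij t i j : N s 0 j = 0 -> N s i 0 = 0 -> N s i j = 0 -> N t i j = 0.
    move=> s0j si0 sij; have := congr2 (fun a b => a - b)
      (rank1_minor 0 0 i j (rkN (s + t))) (rank1_minor 0 0 i j (rkN t)).
    rewrite /= !ND s0j si0 sij !add0r subrr Ns mxE /= mulr1n => <-; comring.
  exists ShapeS, 1%:M, 1%:M; split; rewrite ?unitmx1// => t.
  rewrite mulmx1 mul1mx; apply/matrixP; apply: ord3P; apply: ord3P;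
    by rewrite mxE //= Nij // Ns mxE.
exists ShapeR, 1%:M, 1%:M; split; rewrite ?unitmx1// => t.
suff -> : M t = 0.
  rewrite mulmx0 mul0mx; apply/matrixP=> i j.
  by rewrite !mxE; case: ifP.
apply/eqP; rewrite -mxrank_eq0; move: (rk t).
case rt: (\rank (M t)) => [|[|[|r]]] // _.
  by case: no1; exists t.
by case: no2; exists t.
Qed.

End Classification.

(** * The singular locus is the union of the orbits *)

Lemma orbit_singular s (k : fieldType) n (x : PM k n) :
  Defs.orbit (@shape_set s n) x -> singular_locus k n x.
Proof.
case/orbitP => K [iota [f [g [T [_ _ Ts _ /singular_locusP ->]]]]].
rewrite lform_act; apply/det_act/(det_has_shape (s := s)).
exact/lform_has_shape.
Qed.

Lemma singular_orbit (k : fieldType) n (x : PM k n) :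
  singular_locus k n x -> exists s, Defs.orbit (@shape_set s n) x.
Proof.
have [K [iota [v [vx v0 [alpha [alpha0 alpha1]]]]]] := residue_point x.
pose T l : 'M[K]_3 := \matrix_(i, j) v (enum_rank ((i, j, l) : coord_idx n)).
have Tv : tcoords T = v.
  apply/funext => a; rewrite -[a in RHS]enum_valK /tcoords.
  by case: (enum_val a) => -[i j] l; rewrite mxE.
rewrite -{}Tv in vx v0 => /(singular_locusP vx) detT.
pose M (t : 'rV[K]_n) : 'M[K]_3 := \sum_l t 0 l *: T l.
have M_family : is_family M.
  move=> a t u; rewrite /M scaler_sumr -big_split; apply: eq_bigr => l _ /=.
  by rewrite !mxE scalerDl scalerA.
have [|s [f [g [fU gU Ms]]]] :=
    normal_shape_singular alpha0 alpha1 M_family.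
  by move=> t; apply: det_lform0.
have ME l : M (delta_mx 0 l) = T l.
  rewrite /M (bigD1 l)//= big1 => [|l' ne]; rewrite mxE ?eqxx ?scale1r ?addr0//.
  by rewrite (negbTE ne) andbF scale0r.
pose S l := f *m T l *m g.
have TS : T = tact (invmx f) (invmx g)^T S.
  apply/funext => l; rewrite /tact trmxK -!mulmxA mulmxV // mulmx1.
  by rewrite mulKmx.
exists s; apply/orbitP.
exists K, iota, (invmx f), (invmx g)^T, S; split.
- by rewrite unitmx_inv.
- by rewrite unitmx_tr unitmx_inv.
- by move=> l; rewrite /S -ME; apply: Ms.
- have [l Tl] := (tcoords_neq0 T).2 v0; exists l; apply: contraNneq Tl => Sl.
  by rewrite TS /tact Sl mulmx0 mul0mx.
- by rewrite -TS.
Qed.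

(** * Generic points of the orbits *)

Definition generic_tensor (k : fieldType) n (l : 'I_n) :
    'M[{mpoly k[#|coord_idx n|]}]_3 :=
  \matrix_(i, j) 'X_(enum_rank ((i, j, l) : coord_idx n)).

Lemma map_generic_tensor (k : fieldType) n (S : comNzRingType)
    (iota : {rmorphism k -> S}) (T : 'I_n -> 'M[S]_3) l :
  map_mx (evalp iota (tcoords T)) (generic_tensor k l) = T l.
Proof. by apply/matrixP => i j; rewrite !mxE evalpX tcoordsE. Qed.

(** The parameters (f, g, T) of a point of an orbit form a single tensor with
    n + 2 slices, f and g being the first two; T is then projected onto the
    shape. *)
Definition tensor_of_params s n (R : comNzRingType) (Y : 'I_(2 + n) -> 'M[R]_3) :
    'I_n -> 'M[R]_3 :=
  tact (Y (lshift n 0)) (Y (lshift n 1)) (fun l => to_shape s (Y (rshift 2 l))).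

Definition params_of n (R : comNzRingType) (f g : 'M[R]_3) (T : 'I_n -> 'M[R]_3) :
    'I_(2 + n) -> 'M[R]_3 :=
  fun a => match fintype.split a with
           | inl b => if b == 0 then f else g
           | inr l => T l
           end.

Lemma tensor_of_paramsK s n (R : comNzRingType) f g (T : 'I_n -> 'M[R]_3) :
  (forall l, has_shape s (T l)) -> tensor_of_params s (params_of f g T) = tact f g T.
Proof.
move=> Ts; apply/funext => l.
rewrite /tensor_of_params /params_of /tact.
rewrite !(unsplitK (inl _ : 'I_2 + 'I_n)%type).
by rewrite (unsplitK (inr _ : 'I_2 + 'I_n)%type) Ts.
Qed.

(** D stands for a polynomial with integer coefficients in the entries of a
    tensor. *)
Definition natural_in n (D : forall R : comNzRingType, ('I_n -> 'M[R]_3) -> R) :=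
  forall (R S : comNzRingType) (phi : {rmorphism R -> S}) T,
    phi (D R T) = D S (fun l => map_mx phi (T l)).

Lemma evalp_comp (k : fieldType) N (R S : comNzRingType)
    (theta : {rmorphism k -> R}) (iota : {rmorphism k -> S})
    (phi : {rmorphism R -> S}) (v : 'I_N -> R) (w : 'I_N -> S) p :
  (forall a, phi (theta a) = iota a) -> (forall i, phi (v i) = w i) ->
  phi (evalp theta v p) = evalp iota w p.
Proof.
move=> phiC phiv.
apply: (rmorph_mpoly_ext (phi := phi \o evalp theta v) (psi := evalp iota w)).
  by move=> a; rewrite /= !evalpC.
by move=> i; rewrite /= !evalpX.
Qed.

Lemma map_tcoords n (R S : nzRingType) (phi : {rmorphism R -> S})
    (T : 'I_n -> 'M[R]_3) a :
  phi (tcoords T a) = tcoords (fun l => map_mx phi (T l)) a.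
Proof. by rewrite /tcoords; case: (enum_val a) => -[i j] l; rewrite mxE. Qed.

Lemma map_tensor_of_params s n (R S : comNzRingType) (phi : {rmorphism R -> S})
    (Y : 'I_(2 + n) -> 'M[R]_3) :
  (fun l => map_mx phi (tensor_of_params s Y l)) = tensor_of_params s (fun l => map_mx phi (Y l)).
Proof.
apply/funext => l; rewrite /tensor_of_params map_tact /tact.
by rewrite map_to_shape.
Qed.

(** K is the field of rational functions in the entries of f, g and T.  A
    polynomial D that is not zero at some tensor over k of the given shape is
    not zero at the generic one, by specialization; with f and g specialized to
    the identity, the same argument shows that f and g are invertible. *)
Lemma generic_point s (k : fieldType) n : (0 < n)%N ->
  exists (x : PM k n) (K : fieldType) (iota : {rmorphism k -> K})
      (f g : 'M[K]_3) (T : 'I_n -> 'M[K]_3),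
  [/\ [/\ f \in unitmx, g \in unitmx, forall l, has_shape s (T l) &
        exists l, T l != 0], point_of iota (tcoords (tact f g T)) x,
      forall D, natural_in D ->
        (exists2 T0, forall l, has_shape s (T0 l) & D k T0 != 0) ->
        D K T != 0 &
      forall y, Defs.orbit (@shape_set s n) y ->
        forall p, p \in proj_ideal x -> p \in proj_ideal y].
Proof.
move=> n0; pose A := {mpoly k[#|coord_idx (2 + n)|]}.
pose F : fieldType := {fraction A}.
pose frac : {rmorphism A -> F} := @FracField.tofrac A.
have frac_eq0 a : (frac a == 0) = (a == 0) by apply: tofrac_eq0.
pose theta : {rmorphism k -> A} := @mpolyC #|coord_idx (2 + n)| k.
pose iota : {rmorphism k -> F} := frac \o theta.
pose Y : 'I_(2 + n) -> 'M[A]_3 := @generic_tensor k (2 + n).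
pose f := map_mx frac (Y (lshift n 0)); pose g := map_mx frac (Y (lshift n 1)).
pose T l := map_mx frac (to_shape s (Y (rshift 2 l))).
have Ts l : has_shape s (T l) by apply/map_has_shape/to_shapeK.
have frac_neq0 (S : fieldType) (phi : {rmorphism A -> S}) a :
    phi a != 0 -> frac a != 0.
  by rewrite frac_eq0; apply: contraNneq => ->; rewrite rmorph0.
pose spec (S : fieldType) (io : {rmorphism k -> S}) f0 g0 (T0 : 'I_n -> 'M[S]_3) :
  {rmorphism A -> S} := evalp io (tcoords (params_of f0 g0 T0)).
have specY (S : fieldType) (io : {rmorphism k -> S}) f0 g0 T0 l :
    map_mx (spec S io f0 g0 T0) (Y l) = params_of f0 g0 T0 l.
  exact: map_generic_tensor.
have D_neq0 D : natural_in D ->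
    (exists2 T0, forall l, has_shape s (T0 l) & D k T0 != 0) -> D F T != 0.
  move=> natD [T0 T0s DT0]; rewrite /T -natD.
  apply: (frac_neq0 _ (spec k idfun 1%:M 1%:M T0)); rewrite natD.
  suff -> : (fun l => map_mx (spec k idfun 1%:M 1%:M T0)
               (to_shape s (Y (rshift 2 l)))) = T0 by [].
  apply/funext => l; rewrite map_to_shape specY.
  by rewrite /params_of (unsplitK (inr _ : 'I_2 + 'I_n)%type) T0s.
have unit_at (b : 'I_2) : map_mx frac (Y (lshift n b)) \in unitmx.
  rewrite unitmxE det_map_mx unitfE.
  apply: (frac_neq0 _ (spec k idfun 1%:M 1%:M (fun=> 0))).
  rewrite -det_map_mx specY /params_of (unsplitK (inl _ : 'I_2 + 'I_n)%type).
  by rewrite if_same det1 oner_neq0.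
have T0 : exists l, T l != 0.
  exists (Ordinal n0).
  have : T (Ordinal n0) 0 1 != 0.
    apply: (D_neq0 (fun R N => N (Ordinal n0) 0 1)).
      by move=> R S phi N; rewrite mxE.
    exists (fun=> to_shape s (const_mx 1)) => [l|]; first exact: to_shapeK.
    by case: s {Ts T D_neq0}; rewrite !mxE /= oner_neq0.
  by apply: contraNneq => ->; rewrite mxE.
have vE a : tcoords (tact f g T) a = frac (tcoords (tensor_of_params s Y) a).
  rewrite map_tcoords map_tensor_of_params /tensor_of_params /tact; congr (tcoords _ a).
  by apply/funext => l; rewrite /f /g /T map_to_shape.
have [x xE] : exists x : PM k n, point_of iota (tcoords (tact f g T)) x.
  apply: exists_point; apply/tcoords_neq0.
  case: T0 => l Tl; exists l; apply: contraNneq Tl => fTg.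
  have gTU : g^T \in unitmx by rewrite unitmx_tr; apply: unit_at.
  rewrite -[T l](mulKmx (unit_at 0)) -[_ *m T l](mulmxK gTU).
  by rewrite -/(tact f g T l) fTg mul0mx mulmx0.
exists x, F, iota, f, g, T; split=> //.
  by split=> //; apply: unit_at.
move=> y.
case/orbitP => K [io [f0 [g0 [S [f0U g0U Ss S0 yE]]]]].
apply: homog_sub_sub => d p pd.
have -> : (p \in proj_ideal x) = (evalp iota (tcoords (tact f g T)) p == 0).
  exact: xE pd.
have -> : (p \in proj_ideal y) = (evalp io (tcoords (tact f0 g0 S)) p == 0).
  exact: yE pd.
have <- : frac (evalp theta (tcoords (tensor_of_params s Y)) p) =
    evalp iota (tcoords (tact f g T)) p.
  by apply: evalp_comp => // a; rewrite vE.
rewrite frac_eq0 => /eqP p0; apply/eqP.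
transitivity (spec K io f0 g0 S (evalp theta (tcoords (tensor_of_params s Y)) p)).
  apply/esym/evalp_comp => [a|a]; first exact: (evalpC io).
  rewrite map_tcoords map_tensor_of_params -(tensor_of_paramsK f0 g0 Ss).
  by congr (tcoords (tensor_of_params s _) a); apply/funext => l; rewrite specY.
by rewrite p0 rmorph0.
Qed.

(** * Determinants separating the orbits *)

(** The polynomial D defines a closed set that contains the orbit of shape s'
    but not the k-point T0. *)
Lemma separation s s' (k : fieldType) n d
    (D : forall R : comNzRingType, ('I_n -> 'M[R]_3) -> R)
    (T0 : 'I_n -> 'M[k]_3) :
  natural_in D ->
  (forall N : 'I_n -> 'M[{mpoly k[#|coord_idx n|]}]_3,
     (forall l i j, N l i j \is 1.-homog) -> D _ N \is d.-homog) ->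
  (forall (K : fieldType) (f g : 'M[K]_3) T, f \in unitmx -> g \in unitmx ->
     (forall l, has_shape s' (T l)) -> D K (tact f g T) = 0) ->
  (forall l, has_shape s (T0 l)) -> (exists l, T0 l != 0) -> D k T0 != 0 ->
  ~ @orbit_closure s k n `<=` @orbit_closure s' k n.
Proof.
move=> natD homD zeroD T0s T00 DT0 ss'.
pose p := D _ (@generic_tensor k n).
have pE (K : fieldType) (iota : {rmorphism k -> K}) T :
    evalp iota (tcoords T) p = D K T.
  rewrite -[LHS]/((evalp iota (tcoords T) : {rmorphism _ -> _}) p) natD.
  by congr (D K _); apply/funext => l; apply: map_generic_tensor.
have p_homog : p \is d.-homog.
  by apply: homD => l i j; rewrite mxE dhomogX /= mdeg1.
have [y yE] : exists y : PM k n, point_of idfun (tcoords T0) y.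
  by apply: exists_point; apply/tcoords_neq0.
have : @orbit_closure s k n y.
  apply: subset_closure; apply/orbitP; exists k, idfun, 1%:M, 1%:M, T0.
  split; rewrite ?unitmx1//.
  by rewrite (_ : tact _ _ _ = T0)//; apply/funext => l;
    rewrite /tact mul1mx trmx1 mulmx1.
move=> /ss'; rewrite /orbit_closure closureE.
move=> /(_ (zeros [set p])) yp; move: DT0; rewrite -(pE k idfun) => /negP; apply.
rewrite -[_ == 0](yE d p p_homog); apply: yp => //; split.
  exact: closed_zeros.
move=> x /orbitP[K [iota [f [g [T [fU gU Ts _ xE]]]]]] _ ->.
have -> : (p \in proj_ideal x) = (evalp iota (tcoords (tact f g T)) p == 0).
  exact: xE p_homog.
by rewrite pE zeroD.
Qed.

Definition tr_shape s :=
  match s with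
  | ShapeR => ShapeC | ShapeC => ShapeR | ShapeS => ShapeS | ShapeA => ShapeA
  end.

Lemma tr_has_shape s (R : zmodType) (m : 'M[R]_3) :
  has_shape s m -> has_shape (tr_shape s) m^T.
Proof.
move=> /matrixP ms; apply/matrixP => i j; rewrite mxE [RHS]mxE -ms.
case: s {ms} (ms) => ms /=; rewrite !mxE //.
  by rewrite orbC.
have := ms j i; have := ms i j; rewrite !mxE.
by case: ltngtP => // _ e1 e2; rewrite -?e1 ?opprK // -e2.
Qed.

(** D applied to transposed tensors separates the transposed shapes. *)
Lemma separation_both s s' (k : fieldType) n d
    (D : forall R : comNzRingType, ('I_n -> 'M[R]_3) -> R)
    (T0 : 'I_n -> 'M[k]_3) :
  natural_in D ->
  (forall N : 'I_n -> 'M[{mpoly k[#|coord_idx n|]}]_3,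
     (forall l i j, N l i j \is 1.-homog) -> D _ N \is d.-homog) ->
  (forall (K : fieldType) (f g : 'M[K]_3) T, f \in unitmx -> g \in unitmx ->
     (forall l, has_shape s' (T l)) -> D K (tact f g T) = 0) ->
  (forall l, has_shape s (T0 l)) -> (exists l, T0 l != 0) -> D k T0 != 0 ->
  ~ @orbit_closure s k n `<=` @orbit_closure s' k n /\
  ~ @orbit_closure (tr_shape s) k n `<=` @orbit_closure (tr_shape s') k n.
Proof.
move=> natD homD zeroD T0s [l0 T00] DT0; split.
  by apply: (separation natD homD zeroD T0s) => //; exists l0.
apply: (@separation _ _ _ _ d (fun R N => D R (fun l => (N l)^T))
  (fun l => (T0 l)^T)).
- move=> R S phi T; rewrite natD; congr (D S _); apply/funext => l.
  by rewrite map_trmx.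
- by move=> N Nlin; apply: homD => l i j; rewrite mxE.
- move=> K f g T fU gU Ts.
  rewrite (_ : (fun l => _) = tact g f (fun l => (T l)^T)); last first.
    by apply/funext => l; rewrite /tact !trmx_mul trmxK mulmxA.
  apply: zeroD => // l; have := tr_has_shape (Ts l); by case: (s').
- by move=> l; apply: tr_has_shape.
- by exists l0; rewrite -(inj_eq trmx_inj) trmxK trmx0.
- by rewrite (_ : (fun l => _) = T0) //; apply/funext => l; rewrite trmxK.
Qed.

Lemma sum3E (V : nmodType) (F : 'I_3 -> V) : \sum_i F i = F 0 + F 1 + F 2.
Proof.
rewrite !big_ord_recl big_ord0 addr0 addrA.
by congr (_ + F _ + F _); apply: val_inj.
Qed.

Section Covariants.
Context {n : nat}.

Definition det_columns (l : 'I_3 -> 'I_n) (j : 'I_3 -> 'I_3) (R : comNzRingType)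
    (N : 'I_n -> 'M[R]_3) : R :=
  \det (\matrix_(i, c) N (l c) i (j c)).

Definition det_top_rows (l : 'I_3 -> 'I_n) (R : comNzRingType)
    (N : 'I_n -> 'M[R]_3) : R :=
  \det (\matrix_(c, j < 3) N (l c) 0 j).

(** The cross product of two vectors of length 3. *)
Definition cross (R : comNzRingType) (u v : 'I_3 -> R) (j : 'I_3) : R :=
  if j == 0 then u 1 * v 2 - u 2 * v 1
  else if j == 1 then u 2 * v 0 - u 0 * v 2
  else u 0 * v 1 - u 1 * v 0.

Definition det_cross (a b : 'I_3 -> 'I_3) (S : 'I_3 -> pred 'I_n)
    (R : comNzRingType) (N : 'I_n -> 'M[R]_3) : R :=
  \det (\matrix_(c, j < 3) cross ((\sum_(l | S c l) N l) (a c))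
                                 ((\sum_(l | S c l) N l) (b c)) j).

Lemma natural_det_columns l j : natural_in (@det_columns l j).
Proof.
move=> R S phi N; rewrite /det_columns -det_map_mx; congr (\det _).
by apply/matrixP => i c; rewrite !mxE.
Qed.

Lemma natural_det_top_rows l : natural_in (@det_top_rows l).
Proof.
move=> R S phi N; rewrite /det_top_rows -det_map_mx; congr (\det _).
by apply/matrixP => i c; rewrite !mxE.
Qed.

Lemma natural_det_cross a b S : natural_in (@det_cross a b S).
Proof.
move=> R R' phi N; rewrite /det_cross -det_map_mx; congr (\det _).
have E c i j : phi ((\sum_(l | S c l) N l) i j) =
    (\sum_(l | S c l) map_mx phi (N l)) i j.
  by rewrite !summxE rmorph_sum; apply: eq_bigr => l _; rewrite mxE.
by apply/matrixP => c; apply: ord3P; rewrite !mxE /cross /= rmorphB !rmorphM !E.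
Qed.

Section Homogeneity.
Context (R : comNzRingType) (m : nat) (N : 'I_n -> 'M[{mpoly R[m]}]_3).
Context (N1 : forall l i j, N l i j \is 1.-homog).

Lemma homog_det_columns l j : det_columns l j N \is (3 * 1).-homog.
Proof. by apply: det_homog => i c; rewrite mxE. Qed.

Lemma homog_det_top_rows l : det_top_rows l N \is (3 * 1).-homog.
Proof. by apply: det_homog => i c; rewrite mxE. Qed.

Lemma homog_det_cross a b S : det_cross a b S N \is (3 * 2).-homog.
Proof.
have sum1 c i j : (\sum_(l | S c l) N l) i j \is 1.-homog.
  by rewrite summxE; apply: rpred_sum => l _.
apply: det_homog => c; apply: ord3P; rewrite mxE /cross /=;
  by apply: rpredB; apply: (dhomogM (d := 1) (e := 1)).
Qed.

End Homogeneity.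

Section Vanishing.
Context (K : fieldType).

Add Ring vanishing_field_ring : (comring_theory K).
Ltac comring := comring_for (K : comNzRingType).

Lemma det0_left (A : 'M[K]_3) (u : 'rV_3) : u != 0 -> u *m A = 0 -> \det A = 0.
Proof. by move=> u0 uA; apply/eqP/det0P; exists u. Qed.

Lemma det0_right (A : 'M[K]_3) (u : 'cV_3) : u != 0 -> A *m u = 0 -> \det A = 0.
Proof.
move=> u0 Au; rewrite -det_tr; apply: (@det0_left _ u^T).
  by rewrite -(inj_eq trmx_inj) trmxK trmx0.
by rewrite -trmx_mul Au trmx0.
Qed.

Context (f g : 'M[K]_3) (T : 'I_n -> 'M[K]_3).
Context (fU : f \in unitmx) (gU : g \in unitmx).

(** The last row of f^-1 kills all the f T_l g^t on the left. *)
Lemma det_columns_eq0 l j :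
  (forall l, has_shape ShapeR (T l)) -> det_columns l j (tact f g T) = 0.
Proof.
move=> Ts; pose u : 'rV[K]_3 := delta_mx 0 2 *m invmx f.
have uN t : u *m tact f g T t = 0.
  rewrite /tact !mulmxA mulmxKV// -rowE; apply/rowP => c.
  rewrite !mxE big1 // => a _.
  by have /matrixP/(_ 2 a) := Ts t; rewrite !mxE /= => <-; rewrite mul0r.
apply: (@det0_left _ u).
  apply/eqP => /(congr1 (mulmx^~ f)); rewrite mulmxKV// mul0mx.
  by move/matrixP/(_ 0 2); rewrite !mxE !eqxx => /eqP; rewrite oner_eq0.
apply/rowP => c; have e : (u *m tact f g T (l c)) 0 (j c) = 0 by rewrite uN mxE.
rewrite [RHS]mxE -e mxE [RHS]mxE; apply: eq_bigr => i _; congr (_ * _).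
by rewrite mxE.
Qed.

Lemma alternating_form (v : 'rV[K]_3) t : has_shape ShapeA (T t) ->
  v *m T t *m v^T = 0.
Proof.
move=> <-; apply/rowP => c; rewrite !ord1 !mxE.
rewrite !sum3E !mxE !sum3E !mxE /=.
comring.
Qed.

(** The row of index 0 of f T_l g^t is f_0 T_l g^t, which g^-t f_0^t kills on
    the right since T_l is alternating. *)
Lemma det_top_rows_eq0 l :
  (forall l, has_shape ShapeA (T l)) -> det_top_rows l (tact f g T) = 0.
Proof.
move=> Ts; pose u : 'cV[K]_3 := invmx g^T *m (row 0 f)^T.
have gtU : g^T \in unitmx by rewrite unitmx_tr.
apply: (@det0_right _ u).
  apply/eqP => /(congr1 (mulmx g^T)); rewrite mulKVmx// mulmx0.
  move=> /(congr1 trmx); rewrite trmxK trmx0 rowE.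
  move=> /(congr1 (mulmx^~ (invmx f))); rewrite mulmxK// mul0mx.
  by move/matrixP/(_ 0 0); rewrite !mxE !eqxx => /eqP; rewrite oner_eq0.
apply/colP => c.
have : row 0 (tact f g T (l c)) *m u = 0.
  rewrite /tact !row_mul /u mulmxA mulmxK//.
  exact: alternating_form.
move/rowP/(_ 0); rewrite [RHS]mxE => e.
rewrite [RHS]mxE -e mxE [RHS]mxE; apply: eq_bigr => i _; congr (_ * _).
by rewrite !mxE.
Qed.

(** A matrix M of shape S is e_0 rho + y e_0^t for a row rho and a column y, so
    that all the rows of f M g^t are combinations of rho g^t and of the
    transpose beta of the first column of g; their cross products are
    orthogonal to beta. *)
Lemma det_cross_eq0 a b S :
  (forall l, has_shape ShapeS (T l)) -> det_cross a b S (tact f g T) = 0.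
Proof.
move=> Ts; apply: (@det0_right _ (col 0 g)).
  rewrite colE; apply/eqP => /(congr1 (mulmx (invmx g))); rewrite mulKmx// mulmx0.
  by move/matrixP/(_ 0 0); rewrite !mxE !eqxx => /eqP; rewrite oner_eq0.
apply/colP => c; rewrite mxE sum3E !mxE.
pose M : 'M[K]_3 := \sum_(l | S c l) T l.
have -> : \sum_(l | S c l) tact f g T l = f *m M *m g^T.
  by rewrite mulmx_sumr mulmx_suml.
have M0 (i j : 'I_3) : i != 0 -> j != 0 -> M i j = 0.
  move=> i0 j0; rewrite summxE big1// => t _; have /matrixP/(_ i j) := Ts t.
  by rewrite mxE (negbTE i0) (negbTE j0).
pose rho j := M 0 1 * g j 1 + M 0 2 * g j 2.
pose y i := f i 0 * M 0 0 + f i 1 * M 1 0 + f i 2 * M 2 0.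
have ME i j : (f *m M *m g^T) i j = f i 0 * rho j + y i * g j 0.
  rewrite !mulmx3E !mxE (M0 1 1) ?(M0 1 2) ?(M0 2 1) ?(M0 2 2)// /rho /y.
  comring.
by rewrite /cross /= !ME; comring.
Qed.

End Vanishing.

End Covariants.

(** * Orbits not contained in the closure of another *)

Section Incomparable.
Context (k : fieldType) (n : nat).

Add Ring base_field_ring : (comring_theory k).
Ltac comring := comring_for (k : comNzRingType).

Definition not_below s s' : Prop :=
  ~ @orbit_closure s k n `<=` @orbit_closure s' k n.

Definition both_not_below s s' : Prop :=
  not_below s s' /\ not_below (tr_shape s) (tr_shape s').

Section TwoVariables.
Context (n2 : (2 <= n)%N).

Definition var0 : 'I_n := Ordinal (ltnW n2).
Definition var1 : 'I_n := Ordinal n2.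

Definition pencil (A B : 'M[k]_3) (l : 'I_n) : 'M[k]_3 :=
  if l == var0 then A else if l == var1 then B else 0.

Lemma pencil0 A B : pencil A B var0 = A.
Proof. by rewrite /pencil eqxx. Qed.

Lemma pencil1 A B : pencil A B var1 = B.
Proof. by rewrite /pencil eqxx. Qed.

Lemma has_shape0 s : has_shape s (0 : 'M[k]_3).
Proof.
apply/matrixP => i j; case: s; rewrite !mxE //;
  by do ?[case: ifP => _]; rewrite ?oppr0.
Qed.

Lemma pencil_shape s A B : has_shape s A -> has_shape s B ->
  forall l, has_shape s (pencil A B l).
Proof.
move=> As Bs l; rewrite /pencil; case: ifP => // _; case: ifP => // _.
exact: has_shape0.
Qed.

(** The conditions on A and B say that the first columns of A and B and the
    second column of A are nonzero multiples of the vectors of the canonical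
    basis. *)
Lemma not_below_R s (A B : 'M[k]_3) : has_shape s A -> has_shape s B ->
  A 0 0 = 0 -> A 1 0 != 0 -> A 2 0 = 0 -> B 0 0 = 0 -> B 1 0 = 0 ->
  B 2 0 != 0 -> A 0 1 != 0 -> A 1 1 = 0 -> A 2 1 = 0 ->
  both_not_below s ShapeR.
Proof.
move=> As Bs A00 A10 A20 B00 B10 B20 A01 A11 A21.
pose l (c : 'I_3) := if c == 1 then var1 else var0.
pose j (c : 'I_3) : 'I_3 := if c == 2 then 1 else 0.
apply: (separation_both (T0 := pencil A B) (D := det_columns l j)).
- exact: natural_det_columns.
- by move=> N N1; apply: homog_det_columns.
- move=> K f g T fU gU; exact: det_columns_eq0.
- exact: pencil_shape.
- by exists var0; rewrite pencil0; apply: contraNneq A10 => ->; rewrite mxE.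
rewrite /det_columns det3F !mxE /= !pencil0 !pencil1.
rewrite [j 0](_ : _ = 0) // [j 1](_ : _ = 0) // [j 2](_ : _ = 1) //.
rewrite A00 A20 B00 B10 A11 A21.
set d := (X in X != 0).
have -> : d = A 0 1 * (A 1 0 * B 2 0) by rewrite /d; comring.
by rewrite !mulf_neq0.
Qed.

Definition alt_mx (a b c : k) : 'M[k]_3 :=
  mat3 [:: [:: 0; a; b]; [:: - a; 0; c]; [:: - b; - c; 0]].

Lemma alt_mx_shape a b c : has_shape ShapeA (alt_mx a b c).
Proof. by apply/matrixP; apply: ord3P; apply: ord3P; rewrite !mxE. Qed.

Lemma not_below_A_R : both_not_below ShapeA ShapeR.
Proof.
apply: (@not_below_R _ (alt_mx 1 0 0) (alt_mx 0 1 0)).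
1,2: exact: alt_mx_shape.
all: by rewrite mxE /= ?oppr0 ?oppr_eq0 ?oner_neq0.
Qed.

Lemma not_below_S_R : both_not_below ShapeS ShapeR.
Proof.
apply: (@not_below_R _ (alt_mx 1 0 0) (alt_mx 0 1 0)).
1,2: by apply/matrixP; apply: ord3P; apply: ord3P; rewrite !mxE //= oppr0.
all: by rewrite mxE /= ?oppr0 ?oppr_eq0 ?oner_neq0.
Qed.

Lemma not_below_C_R : both_not_below ShapeC ShapeR.
Proof.
apply: (@not_below_R _ (alt_mx 1 0 0)
  (mat3 [:: [:: 0; 0; 0]; [:: 0; 0; 0]; [:: 1; 0; 0]])).
1,2: by apply/matrixP; apply: ord3P; apply: ord3P; rewrite !mxE //= oppr0.
all: by rewrite mxE /= ?oppr0 ?oppr_eq0 ?oner_neq0.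
Qed.

(** The matrix x A + y B has rows (x, y, 0), (0, x, y) and 0.  The cross
    product (y^2, - x y, x^2) of the first two spans the whole space when (x, y)
    ranges over (1, 0), (0, 1) and (1, 1). *)
Lemma not_below_R_S : both_not_below ShapeR ShapeS.
Proof.
pose A : 'M[k]_3 := mat3 [:: [:: 1; 0; 0]; [:: 0; 1; 0]; [:: 0; 0; 0]].
pose B : 'M[k]_3 := mat3 [:: [:: 0; 1; 0]; [:: 0; 0; 1]; [:: 0; 0; 0]].
pose S (c : 'I_3) (l : 'I_n) :=
  if c == 0 then l == var0 else if c == 1 then l == var1
  else (l == var0) || (l == var1).
have v10 : (var1 == var0) = false by [].
apply: (separation_both (T0 := pencil A B)
  (D := det_cross (fun=> 0) (fun=> 1) S)).
- exact: natural_det_cross.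
- by move=> N N1; apply: homog_det_cross.
- move=> K f g T fU gU; exact: det_cross_eq0.
- by apply: pencil_shape; apply/matrixP; apply: ord3P; apply: ord3P; rewrite !mxE.
- exists var0; rewrite pencil0; apply/eqP => /matrixP/(_ 0 0); rewrite !mxE /=.
  by move/eqP; rewrite oner_eq0.
have S0 : \sum_(l | S 0 l) pencil A B l = A by rewrite big_pred1_eq pencil0.
have S1 : \sum_(l | S 1 l) pencil A B l = B by rewrite big_pred1_eq pencil1.
have S2 : \sum_(l | S 2 l) pencil A B l = A + B.
  rewrite (bigD1 var0)//= pencil0 (bigD1 var1) //= ?v10 // pencil1 big1 ?addr0//.
  by move=> l /andP[/andP[_ l0] l1]; rewrite /pencil (negbTE l0) (negbTE l1).
rewrite /det_cross det3F !mxE S0 S1 S2 /cross /= !mxE /=.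
set d := (X in X != 0); have -> : d = -1 by rewrite /d; comring.
by rewrite oppr_eq0 oner_neq0.
Qed.

End TwoVariables.

Section ThreeVariables.
Context (n3 : (3 <= n)%N).

Let var : 'I_3 -> 'I_n := widen_ord n3.

Definition triple (A : 'I_3 -> 'M[k]_3) (l : 'I_n) : 'M[k]_3 :=
  oapp A 0 (insub (l : nat)).

Lemma triple_var A c : triple A (var c) = A c.
Proof. by rewrite /triple /= valK. Qed.

Lemma triple_shape s A : (forall c, has_shape s (A c)) ->
  forall l, has_shape s (triple A l).
Proof.
by move=> As l; rewrite /triple; case: insub => [c|] //=; apply: has_shape0.
Qed.

(** With T_l the matrix unit E_0l, the top rows of the first three slices form
    the canonical basis. *)
Lemma not_below_A s : (forall c, has_shape s (delta_mx 0 c : 'M[k]_3)) ->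
  both_not_below s ShapeA.
Proof.
move=> ds; apply: (separation_both (T0 := triple (delta_mx 0))
  (D := det_top_rows var)).
- exact: natural_det_top_rows.
- by move=> N N1; apply: homog_det_top_rows.
- move=> K f g T fU gU; exact: det_top_rows_eq0.
- exact: triple_shape.
- exists (var 0); rewrite triple_var; apply/eqP => /matrixP/(_ 0 0).
  by rewrite !mxE => /eqP; rewrite oner_eq0.
rewrite /det_top_rows (_ : (\matrix_(_, _) _) = 1%:M) ?det1 ?oner_neq0//.
by apply/matrixP => c j; rewrite !mxE triple_var !mxE eqxx eq_sym.
Qed.

Lemma not_below_R_A : both_not_below ShapeR ShapeA.
Proof.
apply: not_below_A => c; apply/matrixP => i j; rewrite !mxE.
by case: eqP => // ->.
Qed.

Lemma not_below_S_A : both_not_below ShapeS ShapeA.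
Proof.
apply: not_below_A => c; apply/matrixP => i j; rewrite !mxE.
by case: ifP => // /norP[/negbTE->].
Qed.

(** Each slice T_c represents, up to sign, the cross product by e_c, and the
    cross product of its two nonzero rows is e_c. *)
Lemma not_below_A_S : both_not_below ShapeA ShapeS.
Proof.
pose A (c : 'I_3) := alt_mx (c == 2)%:R (- (c == 1)%:R) (c == 0)%:R.
apply: (separation_both (T0 := triple A)
  (D := det_cross (fun c => if c == 0 then 1 else if c == 1 then 2 else 0)
    (fun c => if c == 0 then 2 else if c == 1 then 0 else 1)
    (fun c => pred1 (var c)))).
- exact: natural_det_cross.
- by move=> N N1; apply: homog_det_cross.
- move=> K f g T fU gU; exact: det_cross_eq0.
- by apply: triple_shape => c; apply: alt_mx_shape.
- exists (var 2); rewrite triple_var; apply/eqP => /matrixP/(_ 0 1).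
  by rewrite !mxE /= => /eqP; rewrite oner_eq0.
rewrite /det_cross det3F !mxE !big_pred1_eq !triple_var /cross /= !mxE /=.
set d := (X in X != 0); have -> : d = 1.
  by rewrite /d !(mulr0n, mulr1n); comring.
exact: oner_neq0.
Qed.

End ThreeVariables.

End Incomparable.

(** * The two orbit closures that coincide for two variables *)

(** Row and column operations on T are absorbed by f and g. *)
Lemma orbit_point (s' : mxshape) (k : fieldType) n (x : PM k n) (K : fieldType)
    (iota : {rmorphism k -> K}) (f g p q : 'M[K]_3) (T : 'I_n -> 'M[K]_3) :
  f \in unitmx -> g \in unitmx -> p \in unitmx -> q \in unitmx ->
  (forall l, has_shape s' (p *m T l *m q)) -> (exists l, T l != 0) ->
  point_of iota (tcoords (tact f g T)) x ->
  Defs.orbit (@shape_set s' n) x.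
Proof.
move=> fU gU pU qU Ts [l Tl] xE; apply/orbitP.
exists K, iota, (f *m invmx p), (g *m (invmx q)^T), (fun l => p *m T l *m q).
split=> //.
- by rewrite unitmx_mul fU unitmx_inv.
- by rewrite unitmx_mul gU unitmx_tr unitmx_inv.
- exists l; apply: contraNneq Tl => pTq.
  by rewrite -[T l](mulKmx pU) -[p *m T l](mulmxK qU) pTq mul0mx mulmx0.
- rewrite (_ : tact _ _ _ = tact f g T) //; apply/funext => t; rewrite /tact.
  rewrite trmx_mul trmxK !mulmxA mulmxKV //.
  by rewrite -!mulmxA (mulmxA q) mulmxV // mul1mx.
Qed.

Section Pencils.
Context (K : fieldType).

Add Ring pencil_field_ring : (comring_theory K).
Ltac comring := comring_for (K : comNzRingType).

Lemma cramer2 (a0 b0 a1 b1 u0 u1 : K) : a0 * b1 - a1 * b0 != 0 ->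
  exists x y, a0 * x + b0 * y = u0 /\ a1 * x + b1 * y = u1.
Proof.
move=> d0; pose d := a0 * b1 - a1 * b0.
exists ((u0 * b1 - u1 * b0) / d), ((a0 * u1 - a1 * u0) / d).
rewrite !mulrA -!mulrDl.
by split; apply: (canLR (mulfK d0)); rewrite /d; comring.
Qed.

Lemma ord2P (P : 'I_2 -> Prop) : P 0 -> P 1 -> forall i, P i.
Proof.
move=> P0 P1 [[|[|//]] lti].
  by rewrite (_ : Ordinal lti = 0) //; apply: val_inj.
by rewrite (_ : Ordinal lti = 1) //; apply: val_inj.
Qed.

(** The condition makes the entries T_01 and T_02 independent linear forms in
    two variables, so T_12 is a combination of them, and can be cleared by
    adding multiples of row 0 to the other rows and likewise for columns. *)
Lemma alternating_pencil (T : 'I_2 -> 'M[K]_3) :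
  (forall l, has_shape ShapeA (T l)) ->
  T 0 0 1 * T 1 0 2 - T 1 0 1 * T 0 0 2 != 0 ->
  exists p q, [/\ p \in unitmx, q \in unitmx &
    forall l, has_shape ShapeS (p *m T l *m q)].
Proof.
move=> Ts d0; have [x [y [e0 e1]]] := cramer2 (T 0 1 2) (T 1 1 2) d0.
have e : forall l, T l 1 2 = T l 0 1 * x + T l 0 2 * y by apply: ord2P.
pose p := mat3 [:: [:: 1; 0; 0]; [:: - y; 1; 0]; [:: x; 0; 1]].
pose q := mat3 [:: [:: 1; - y; x]; [:: 0; 1; 0]; [:: 0; 0; 1]].
exists p, q; split.
- by apply: (@mat3_unit _ _ 1); rewrite ?oner_neq0// det3F !mxE /=; comring.
- by apply: (@mat3_unit _ _ 1); rewrite ?oner_neq0// det3F !mxE /=; comring.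
move=> l; apply/matrixP; apply: ord3P; apply: ord3P; rewrite mxE //=;
  rewrite -(Ts l) !mulmx3E !mxE /= ?e; comring.
Qed.

(** The forms T_01, T_02 are a basis of the linear forms in two variables, and
    so are T_10, T_20: a row operation clears T_00, and a change of basis of the
    last two columns turns (T_01, T_02) into - (T_10, T_20). *)
Lemma skew_pencil (T : 'I_2 -> 'M[K]_3) :
  (forall l, has_shape ShapeS (T l)) ->
  T 0 0 1 * T 1 0 2 - T 1 0 1 * T 0 0 2 != 0 ->
  T 0 1 0 * T 1 2 0 - T 1 1 0 * T 0 2 0 != 0 ->
  exists p q, [/\ p \in unitmx, q \in unitmx &
    forall l, has_shape ShapeA (p *m T l *m q)].
Proof.
move=> Ts d0 d'0.
have [r [s [a0 a1]]] := cramer2 (T 0 0 0) (T 1 0 0) d'0.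
have [x [y [b0 b1]]] := cramer2 (T 0 1 0) (T 1 1 0) d0.
have [z [t [c0 c1]]] := cramer2 (T 0 2 0) (T 1 2 0) d0.
have a : forall l, T l 0 0 = T l 1 0 * r + T l 2 0 * s by apply: ord2P.
have b : forall l, T l 1 0 = T l 0 1 * x + T l 0 2 * y by apply: ord2P.
have c : forall l, T l 2 0 = T l 0 1 * z + T l 0 2 * t by apply: ord2P.
pose p := mat3 [:: [:: 1; - r; - s]; [:: 0; 1; 0]; [:: 0; 0; 1]].
pose q := mat3 [:: [:: 1; 0; 0]; [:: 0; - x; - z]; [:: 0; - y; - t]].
exists p, q; split.
- by apply: (@mat3_unit _ _ 1); rewrite ?oner_neq0// det3F !mxE /=; comring.
- apply: (@mat3_unit _ _ (x * t - z * y)); first by rewrite det3F !mxE /=; comring.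
  apply: contraNneq d'0 => xt; rewrite !b !c.
  set w := (X in X == 0).
  have -> : w = (T 0 0 1 * T 1 0 2 - T 1 0 1 * T 0 0 2) * (x * t - z * y).
    by rewrite /w; comring.
  by rewrite xt mulr0.
move=> l; apply/matrixP; apply: ord3P; apply: ord3P; rewrite mxE //=;
  rewrite -(Ts l) !mulmx3E !mxE /= ?a ?b ?c; comring.
Qed.

End Pencils.

(** * Irreducible components *)

Section Components.
Context (k : fieldType) (n : nat) (n0 : (0 < n)%N).

Lemma closed_orbit_closure s : closed (@orbit_closure s k n).
Proof. exact: closed_closure. Qed.

Lemma irreducible_orbit_closure s : irreducible (@orbit_closure s k n).
Proof.
have [x [K [iota [f [g [T [[fU gU Ts T0] xE _ xgen]]]]]]] := generic_point s k n0.
apply: (@irreducible_closure_generic _ _ _ x) => //.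
by apply/orbitP; exists K, iota, f, g, T.
Qed.

Lemma singular_locus_closures :
  singular_locus k n = \bigcup_s @orbit_closure s k n.
Proof.
apply/seteqP; split=> [x /singular_orbit[s sx]|x [s _]].
  by exists s => //; apply: subset_closure.
rewrite /orbit_closure closureE => /(_ (singular_locus k n)); apply.
split; first exact: closed_zeros.
by move=> y; apply: orbit_singular.
Qed.

Lemma irreducible_sub_closure (Y : set (PM k n)) : irreducible Y ->
  Y `<=` singular_locus k n -> exists s, Y `<=` @orbit_closure s k n.
Proof.
move=> [_ Yirr] YF; have cl := closed_orbit_closure.
have : Y `<=` (@orbit_closure ShapeR k n `|` @orbit_closure ShapeS k n) `|`
              (@orbit_closure ShapeA k n `|` @orbit_closure ShapeC k n).
  move=> y /YF; rewrite singular_locus_closures => -[[] _ sy];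
    by [left; left|left; right|right; left|right; right].
have clU s s' := closedU (cl s) (cl s').
case/(Yirr _ _ (clU _ _) (clU _ _)) => /(Yirr _ _ (cl _) (cl _))[] YZ;
  by eexists; apply: YZ.
Qed.

(** An irreducible subset of the union of the four closed sets lies in one of
    them, and each of them is maximal since distinct ones are incomparable. *)
Lemma components_orbit_closures :
  (forall s s', @orbit_closure s k n `<=` @orbit_closure s' k n ->
     @orbit_closure s k n = @orbit_closure s' k n) ->
  irreducible_components (singular_locus k n) =
    [set @orbit_closure s k n | s in setT].
Proof.
move=> anti; apply/seteqP; split=> [Z [ZF Zirr Zmax]|_ [s _ <-]].
  have [s Zs] := irreducible_sub_closure Zirr ZF.
  exists s => //; apply: Zmax => //; last exact: irreducible_orbit_closure.
  by rewrite singular_locus_closures => y sy; exists s.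
split; first by rewrite singular_locus_closures => y sy; exists s.
  exact: irreducible_orbit_closure.
move=> Y YF Yirr sY; have [s' Ys'] := irreducible_sub_closure Yirr YF.
have ss' : @orbit_closure s k n = @orbit_closure s' k n.
  by apply: anti; apply: subset_trans Ys'.
by apply/seteqP; split=> //; rewrite ss'.
Qed.

(** To include the closure of an orbit in another, it is enough to treat the
    generic point, for which any polynomial inequation that holds somewhere on
    the shape may be assumed. *)
Lemma orbit_closure_sub s s' :
  (forall (x : PM k n) (K : fieldType) (iota : {rmorphism k -> K})
      (f g : 'M[K]_3) (T : 'I_n -> 'M[K]_3),
     f \in unitmx -> g \in unitmx -> (forall l, has_shape s (T l)) ->
     (exists l, T l != 0) -> point_of iota (tcoords (tact f g T)) x ->
     (forall D, natural_in D ->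
        (exists2 T0, forall l, has_shape s (T0 l) & D k T0 != 0) ->
        D K T != 0) ->
     Defs.orbit (@shape_set s' n) x) ->
  @orbit_closure s k n `<=` @orbit_closure s' k n.
Proof.
move=> h; have [x [K [iota [f [g [T [[fU gU Ts T0] xE xD xgen]]]]]]] :=
  generic_point s k n0.
have s'x : Defs.orbit (@shape_set s' n) x by apply: (h x K iota f g T).
rewrite /orbit_closure (closure_generic (x := x)) => [y xy||//]; last first.
  by apply/orbitP; exists K, iota, f, g, T.
rewrite closureE => B [/closedP[E ->] sE] p Ep.
by apply: xy; apply: sE.
Qed.

End Components.

Section Assembly.
Context (k : fieldType) (n : nat) (n2 : (2 <= n)%N).

(** The tensor T0 has both shapes and both 2 x 2 determinants are nonzero at it,
    so that the generic tensor of either shape can be brought to the other. *)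
Lemma orbit_closure_A_eq_S (n_eq2 : n = 2%N) :
  @orbit_closure ShapeA k n = @orbit_closure ShapeS k n.
Proof.
move: n2; rewrite n_eq2 => _.
pose rows (R : comNzRingType) (N : 'I_2 -> 'M[R]_3) :=
  N 0 0 1 * N 1 0 2 - N 1 0 1 * N 0 0 2.
pose columns (R : comNzRingType) (N : 'I_2 -> 'M[R]_3) :=
  N 0 1 0 * N 1 2 0 - N 1 1 0 * N 0 2 0.
have nat_rows : natural_in rows.
  by move=> R S phi N; rewrite /rows rmorphB !rmorphM !mxE.
have nat_columns : natural_in columns.
  by move=> R S phi N; rewrite /columns rmorphB !rmorphM !mxE.
pose T0 (l : 'I_2) := alt_mx (l == 0)%:R (l == 1)%:R 0 : 'M[k]_3.
have T0A l : has_shape ShapeA (T0 l) by apply: alt_mx_shape.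
have T0S l : has_shape ShapeS (T0 l).
  by apply/matrixP; apply: ord3P; apply: ord3P; rewrite !mxE //= oppr0.
have rowsT0 : rows _ T0 != 0.
  by rewrite /rows !mxE /= !(mulr0n, mulr1n) !mulr1 mulr0 subr0 oner_neq0.
have columnsT0 : columns _ T0 != 0.
  rewrite /columns !mxE /= !(mulr0n, mulr1n) oppr0 mulrNN mulr1 mulr0 subr0.
  exact: oner_neq0.
apply/seteqP; split; apply: orbit_closure_sub => // x K iota f g T fU gU Ts Tn0 xE xD.
  have [|p [q [pU qU pTq]]] := alternating_pencil Ts.
    by apply: (xD rows nat_rows); exists T0.
  exact: (orbit_point fU gU pU qU pTq Tn0 xE).
have [||p [q [pU qU pTq]]] := skew_pencil Ts.
- by apply: (xD rows nat_rows); exists T0.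
- by apply: (xD columns nat_columns); exists T0.
exact: (orbit_point fU gU pU qU pTq Tn0 xE).
Qed.

Lemma orbit_closure_sub_eq s s' :
  @orbit_closure s k n `<=` @orbit_closure s' k n -> s = s' \/
  n = 2%N /\ (s = ShapeA \/ s = ShapeS) /\ (s' = ShapeA \/ s' = ShapeS).
Proof.
move=> ss'.
have [A_R A_C] := not_below_A_R k n2; have [S_R S_C] := not_below_S_R k n2.
have [C_R R_C] := not_below_C_R k n2; have [R_S C_S] := not_below_R_S k n2.
have [n_eq2|n_neq2] := eqVneq n 2%N.
  have R_A : not_below k n ShapeR ShapeA.
    by rewrite /not_below orbit_closure_A_eq_S.
  have C_A : not_below k n ShapeC ShapeA.
    by rewrite /not_below orbit_closure_A_eq_S.
  move: ss'; case: s; case: s' => ss'; first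
    [ by left
    | by match goal with below : not_below _ _ _ _ |- _ => case: (below ss') end
    | by right; split; last split; auto ].
have n3 : (2 < n)%N by rewrite ltn_neqAle eq_sym n_neq2.
have [R_A C_A] := not_below_R_A k n3.
have [S_A _] := not_below_S_A k n3; have [A_S _] := not_below_A_S k n3.
left; move: ss'; case: s; case: s' => // ss';
  by match goal with below : not_below _ _ _ _ |- _ => case: (below ss') end.
Qed.

End Assembly.

Lemma image_mxshape (U : Type) (F : mxshape -> U) :
  [set F s | s in setT] = [set F ShapeR; F ShapeS; F ShapeA; F ShapeC].
Proof.
apply/seteqP; split=> [_ [s _ <-]|_ [[[]|]|] ->].
- by case: s; [left; left; left|left; left; right|left; right|right].
- by exists ShapeR.
- by exists ShapeS.
- by exists ShapeA.
- by exists ShapeC.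
Qed.

Local Open Scope card_scope.

Lemma card_uniq_seq (U : eqType) (s : seq U) :
  uniq s -> [set x | x \in s] #= `I_(size s).
Proof.
case: s => [_|x0 s']; last set s := x0 :: s' => us.
  rewrite (_ : mkset _ = set0) ?II0//.
  by apply/seteqP; split=> x //=; rewrite in_nil.
rewrite (_ : mkset _ = nth x0 s @` `I_(size s)); last first.
  apply/seteqP; split=> [x /= xs|_ [i /= si <-]]; last exact: mem_nth.
  exists (index x s); last exact: nth_index.
  by rewrite /mkset index_mem.
apply: inj_card_eq => i j; rewrite !inE /= => si sj /eqP.
by rewrite nth_uniq // => /eqP.
Qed.

Lemma card_set3 (U : eqType) (a b c : U) :
  [/\ a <> b, a <> c & b <> c] -> [set a; b; c] #= `I_3.
Proof.
case=> /eqP ab /eqP ac /eqP bc.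
have /card_uniq_seq : uniq [:: a; b; c] by rewrite /= !inE !negb_or ab ac bc.
congr (_ #= _); apply/seteqP; split=> x /=; rewrite !inE.
  by case/or3P => /eqP ->; [left; left|left; right|right].
by move=> [[]|] ->; rewrite eqxx ?orbT.
Qed.

Lemma card_set4 (U : eqType) (a b c d : U) :
  [/\ a <> b, a <> c, a <> d & [/\ b <> c, b <> d & c <> d]] ->
  [set a; b; c; d] #= `I_4.
Proof.
case=> /eqP ab /eqP ac /eqP ad [/eqP bc /eqP bd /eqP cd].
have /card_uniq_seq : uniq [:: a; b; c; d].
  by rewrite /= !inE !negb_or ab ac ad bc bd cd.
congr (_ #= _); apply/seteqP; split=> x /=; rewrite !inE.
  by case/or4P => /eqP ->; [left; left; left|left; left; right|left; right|right].
by move=> [[[]|]|] ->; rewrite eqxx ?orbT.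
Qed.

Theorem mainTheorem2 (k : fieldType) (n : nat) (hn : (2 <= n)%N) :
  [/\ irreducible_components (singular_locus k n)
        = [set varR k n; varS k n; varA k n; varC k n],
      (3 <= n)%N ->
        [/\ varR k n <> varS k n, varR k n <> varA k n, varR k n <> varC k n &
            [/\ varS k n <> varA k n, varS k n <> varC k n &
                varA k n <> varC k n]] /\
        irreducible_components (singular_locus k n) #= `I_4
    & n = 2%N ->
        [/\ varA k n = varS k n,
            irreducible_components (singular_locus k n)
              = [set varR k n; varA k n; varC k n] &
            irreducible_components (singular_locus k n) #= `I_3]].
Proof.
rewrite -[varR k n]/(@orbit_closure ShapeR k n).
rewrite -[varS k n]/(@orbit_closure ShapeS k n).
rewrite -[varA k n]/(@orbit_closure ShapeA k n).
rewrite -[varC k n]/(@orbit_closure ShapeC k n).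
pose Z s := @orbit_closure s k n; rewrite -!/(Z _).
have components : irreducible_components (singular_locus k n)
        = [set Z ShapeR; Z ShapeS; Z ShapeA; Z ShapeC].
  rewrite components_orbit_closures ?(ltnW hn)//; first exact: image_mxshape.
  move=> s s' /(orbit_closure_sub_eq hn)[->//|[n_eq2 [sAS s'AS]]].
  have AS := orbit_closure_A_eq_S k hn n_eq2.
  by case: sAS s'AS => -> [] ->.
have distinct s s' : s <> s' -> n <> 2%N \/ (s <> ShapeA /\ s' <> ShapeA) ->
    Z s <> Z s'.
  move=> ss' sA /[dup] /seteqP[sub _] eqZ.
  case: (orbit_closure_sub_eq hn sub) => [//|[n_eq2 [sAS s'AS]]].
  case: sA => // -[sA s'A]; apply: ss'.
  by case: sAS => // ->; case: s'AS => // ->.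
split=> // [n3|n_eq2].
  have n_neq2 : n <> 2%N by move=> n_eq2; rewrite n_eq2 in n3.
  have {}distinct s s' : s <> s' -> Z s <> Z s'.
    by move=> ss'; apply: distinct => //; left.
  have all_distinct : [/\ Z ShapeR <> Z ShapeS, Z ShapeR <> Z ShapeA,
      Z ShapeR <> Z ShapeC & [/\ Z ShapeS <> Z ShapeA, Z ShapeS <> Z ShapeC &
      Z ShapeA <> Z ShapeC]].
    by do ?split; apply: distinct.
  by split=> //; rewrite components; apply: card_set4.
have AS : Z ShapeA = Z ShapeS := orbit_closure_A_eq_S k hn n_eq2.
have components3 : irreducible_components (singular_locus k n)
              = [set Z ShapeR; Z ShapeA; Z ShapeC].
  rewrite components -AS; apply/seteqP; split=> Y.
    by move=> [[[]|]|] ->; [left; left|left; right|left; right|right].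
  by move=> [[]|] ->; [left; left; left|left; right|right].
split=> //; rewrite components3; apply: card_set3; rewrite AS.
by split; apply: distinct => //; right; split.
Qed.
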